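(* For every positive integer $n$ we have $s(n+1) \le s(n) + 1$. Moreover, $s(n) - s(n+1) = O(\log\log n)$ as $n \to \infty$, i.e. there is a constant $C>0$ such that $s(n+1) \ge s(n) - C\log\log n$ for all sufficiently large $n$. Finally, \[ \liminf_{n\to\infty} \bigl(s(n+1) - s(n)\bigr) = -\infty. \]
   Context: For a positive integer $n$, $n \bmod k$ denotes the least nonnegative remainder of $n$ upon division by $k$. Let $S(n) := \{ n \bmod k : k \in \{1,2,\ldots,\lfloor n/2\rfloor\}\}$ and $s(n) := |S(n)|$. *)

(* Defs.v *)
From mathcomp Require Import all_boot all_order all_algebra finmap.

Set Implicit Arguments.
Unset Strict Implicit.
Unset Printing Implicit Defensive.

Local Open Scope fset_scope.

Definition S_set (n : nat) : {fset nat} :=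
  [fset (n %% k)%N | k in index_iota 1 (n %/ 2).+1].

Definition s (n : nat) : nat := #|` S_set n|.

(* Main.v *)
Require Import Defs.
From HB Require Import structures.
From mathcomp Require Import all_boot all_order all_algebra finmap.
From mathcomp Require Import all_fingroup all_solvable all_field all_character.
From mathcomp Require Import complex.
From mathcomp Require Import all_classical all_reals all_analysis.
From mathcomp Require Import zify ring lra.

(**
  Write N = n + 1.  The map r -> r + 1 sends all of S(n) into S(N), except the r for which
  r + 1 is the only divisor of n - r in the range ]r, n/2]; those r correspond to the primes p
  such that p + 1 divides N and N / (p + 1) has no prime factor below p.  So
  s(n + 1) = s(n) + 1 - b(N), where b(N) counts these primes ([drops]); the 1 is for 0 in S(N).

  For odd p < p' counted by b(N), p + 1 divides p' + 1 and the quotient only has prime factors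
  >= p, so p' >= p^2: hence b(N) = O(log log N).

  Conversely, for a prime p, Dirichlet's theorem yields a prime p' congruent to p modulo
  (p + 1) * (p - 1)!; then p' + 1 = (p + 1) t with t prime to (p - 1)!, and b(p' + 1)
  exceeds b(p + 1).  Iterating, b is unbounded.

  Dirichlet's theorem is obtained by the elementary method of Mertens and Shapiro: for a
  nonprincipal character chi, the sums T(x) of chi(d) Lambda(d) / d over d <= x are bounded when
  L(1, chi) <> 0, and equal - ln x + O(1) when L(1, chi) = 0.  Positivity of the sum of T(x) over
  all characters allows at most one vanishing L(1, chi), so such a chi is real, which is
  excluded by comparing the Lambert series of chi with that of 1 * chi (Monsky).
*)

Set Implicit Arguments.
Unset Strict Implicit.
Unset Printing Implicit Defensive.

Import Order.TTheory GRing.Theory Num.Theory.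
Import numFieldNormedType.Exports.

(** * Variation of s *)

Lemma mem_S_set n r :
  reflect (exists k, [/\ r < k, k <= n %/ 2, r <= n & k %| n - r]) (r \in S_set n).
Proof.
rewrite /S_set; apply: (iffP (imfsetP _ _ _ _)) => [[k /=]|[k [ltrk lek lern dvdk]]].
  rewrite mem_index_iota => /andP[k0 lek] ->; exists k; split; [exact: ltn_pmod| | |] => //.
    exact: leq_mod.
  by rewrite {1}(divn_eq n k) addnK dvdn_mull.
exists k; first by rewrite /= mem_index_iota; lia.
by rewrite -(subnK lern) -modnDml (eqP dvdk) modn_small.
Qed.

Lemma S_set_lt n r : r \in S_set n -> r < n.
Proof. by case/mem_S_set=> k [? ? ? ?]; lia. Qed.

Lemma s_count n : s n = count (fun r => r \in S_set n) (iota 0 n).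
Proof.
rewrite /s cardfE -size_filter cardE size_map -(size_map val) -enumT.
apply/perm_size/uniq_perm.
- by rewrite (map_inj_uniq val_inj) enum_uniq.
- by rewrite filter_uniq ?iota_uniq.
move=> r; rewrite mem_filter mem_iota add0n; apply/mapP/idP => [[x _ ->]|].
  by rewrite (valP x) (S_set_lt (valP x)).
by case/andP=> rS _; exists [` rS]%fset; rewrite ?mem_enum.
Qed.

(** The same modulus [k] serves, since [n.+1 - r.+1 = n - r]. The only modulus allowed for [n.+1]
    but not for [n] is half of [n.+1], and then [n - r] would lie strictly between [k] and
    [2 * k]. *)
Lemma mem_S_setS n r : r.+1 \in S_set n.+1 -> r \in S_set n.
Proof.
case/mem_S_set=> k [ltrk lek lern dvdk]; apply/mem_S_set.
rewrite subSS in dvdk; exists k; split=> //; try lia.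
have [//|gtk] := leqP k (n %/ 2).
have /dvdnP[c cE] := dvdk.
have : k * 2 = n.+1 by lia.
by case: c cE => [|[|c]]; nia.
Qed.

Lemma mem0_S_setS n : 0 < n -> 0 \in S_set n.+1.
Proof. by move=> n0; apply/mem_S_set; exists 1; split; rewrite ?dvd1n //; lia. Qed.

(* The primes p for which r = N / (p + 1) - 1 lies in S(N - 1) while r + 1 is not in S(N). *)
Definition drop_prime N p :=
  [&& prime p, p.+1 %| N
    & all (fun q => prime q ==> ~~ (q %| N %/ p.+1)) (iota 0 p)].

Lemma drop_primeP N p :
  reflect [/\ prime p, p.+1 %| N
     & forall q, prime q -> q < p -> ~~ (q %| N %/ p.+1)] (drop_prime N p).
Proof.
apply: (iffP and3P) => -[pp dN rough]; split=> //.
  move=> q qp ltq; have : q \in iota 0 p by rewrite mem_iota.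
  by move=> /(allP rough)/implyP; apply.
by apply/allP=> q; rewrite mem_iota => ltq; apply/implyP => qp; apply: rough.
Qed.

Definition drops N := [seq p <- iota 0 N | drop_prime N p].

Lemma mem_drops N p : 0 < N -> (p \in drops N) = drop_prime N p.
Proof.
move=> N0; rewrite mem_filter mem_iota /= add0n andb_idr //.
by case/drop_primeP=> _ /(dvdn_leq N0).
Qed.

(** Write [n.+1 = d * p.+1]. The modulus [d] itself puts [d.-1] in [S_set n]. A modulus [k > d]
    putting [d] in [S_set n.+1] would give [d * p = c * k] with [1 < c < p], and a prime factor of
    [c] would be a prime below [p] dividing [d]. *)
Lemma drops_lost n p : drop_prime n.+1 p ->
  ((n.+1 %/ p.+1).-1 \in S_set n) && ((n.+1 %/ p.+1).-1.+1 \notin S_set n.+1).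
Proof.
case/drop_primeP=> pp /dvdnP[d nE] rough.
have p1 := prime_gt1 pp.
have d0 : 0 < d by case: d nE {rough} => //.
have dE : n.+1 %/ p.+1 = d by rewrite nE mulnK.
rewrite dE in rough *; rewrite prednK //.
apply/andP; split; first apply/mem_S_set.
  exists d; split; [lia|nia|nia|].
  by apply/dvdnP; exists p; nia.
apply/mem_S_set => -[k [ltdk lek led /dvdnP[c cE]]].
have cE' : d * p = c * k by nia.
have cp : c < p by nia.
have c1 : 1 < c by case: c cE cE' cp => [|[|c]] ? ? ?; nia.
have := pdiv_prime c1 => qp.
have ltq : pdiv c < p by apply: leq_ltn_trans cp; rewrite pdiv_leq //; lia.
have := rough _ qp ltq; apply/negP; rewrite negbK.
have: pdiv c %| d * p by rewrite cE' dvdn_mulr // pdiv_dvd.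
rewrite Euclid_dvdM // => /orP[//|]; rewrite dvdn_prime2 // => /eqP; lia.
Qed.

Lemma lost_drops n r : r \in S_set n -> r.+1 \notin S_set n.+1 ->
  drop_prime n.+1 (n.+1 %/ r.+1).-1 /\ r.+1 %| n.+1.
Proof.
move=> rS rNS.
have max_dvd k : k <= n %/ 2 -> k %| n - r -> k <= r.+1.
  move=> lek dvdk; rewrite leqNgt; apply: contra rNS => ltk.
  by apply/mem_S_set; exists k; split; rewrite ?subSS //; [lia|case/mem_S_set: rS => ? []; lia].
case/mem_S_set: rS => k [ltrk lek lern dvdk].
have kE : k = r.+1 by apply/eqP; rewrite eqn_leq max_dvd.
rewrite {k}kE in ltrk lek dvdk.
have /dvdnP[p pE] := dvdk.
have nE : n.+1 = p.+1 * r.+1 by nia.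
have p1 : 1 < p by case: p pE nE => [|[|p]] ? ?; nia.
have dN : r.+1 %| n.+1 by rewrite nE dvdn_mull.
split=> //; rewrite nE mulnK //=.
(* A divisor [c > 1] of [n - r] has a cofactor at most [n %/ 2], hence at most [r.+1] by [max_dvd].
   As [n - r = p * r.+1], this says [p <= c]; so [p] is its own least prime factor, and no prime
   below [p] divides [r.+1]. *)
have small c : 1 < c -> c %| n - r -> n - r <= c * r.+1.
  move=> c1 /dvdnP[k kE]; rewrite {1}kE mulnC leq_mul2l max_dvd ?orbT //; last first.
    by rewrite kE dvdn_mulr.
  by nia.
apply/drop_primeP; rewrite mulKn //; split; last 2 first.
- by rewrite dvdn_mulr.
- move=> q qp ltq; apply/negP => qd.
  have := small q (prime_gt1 qp); rewrite pE dvdn_mull // => /(_ isT); nia.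
have := small _ (prime_gt1 (pdiv_prime p1)).
rewrite {1}pE dvdn_mulr ?pdiv_dvd // => /(_ isT).
rewrite pE leq_pmul2r // => le.
suff -> : p = pdiv p by apply: pdiv_prime.
by apply/eqP; rewrite eqn_leq le pdiv_leq //; lia.
Qed.

(** [S_set n] is split according to whether the successor lies in [S_set n.+1]. The two preceding
    lemmas make [p -> n.+1 / p.+1 - 1] a bijection from [drops n.+1] onto the elements whose
    successor does not. *)
Lemma s_succ n : 0 < n -> (s n).+1 = s n.+1 + size (drops n.+1).
Proof.
move=> n0; rewrite [s n.+1]s_count /= mem0_S_setS // add1n addSn; congr _.+1.
rewrite -[iota 1 n]/(iota (1 + 0) n) iotaDl count_map s_count.
set a := preim _ _.
rewrite -size_filter -[LHS](count_predC a) !count_filter.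
congr addn.
  apply: eq_count => r /=; rewrite /a /= add1n; apply: andb_idr.
  exact: mem_S_setS.
rewrite -size_filter -(size_map (fun p => (n.+1 %/ p.+1).-1) (drops n.+1)).
apply/perm_size/uniq_perm.
- by rewrite filter_uniq ?iota_uniq.
- rewrite map_inj_in_uniq ?filter_uniq ?iota_uniq // => p p'.
  rewrite !mem_drops // => /drop_primeP[_ /dvdnP[d dE] _] /drop_primeP[_ /dvdnP[d' dE'] _].
  by rewrite {1}dE dE' !mulnK //; case: d dE => [|d] dE; case: d' dE' => [|d'] dE'; nia.
move=> r; rewrite mem_filter mem_iota /= /a /= add1n.
apply/idP/mapP => [/andP[/andP[rNS rS] _]|[p]].
  have [dr dvdr] := lost_drops rS rNS.
  exists (n.+1 %/ r.+1).-1; rewrite ?mem_drops //.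
  have /dvdnP[c cE] := dvdr.
  by rewrite cE mulnK //; case: c cE => [|c] // cE; rewrite /= mulKn.
rewrite mem_drops // => /drops_lost/andP[rS rNS] ->.
by rewrite rS rNS /= (S_set_lt rS).
Qed.

(** For odd [p] the prime factors of [p.+1] are below [p], which fails for [p = 2]. Hence they do
    not divide [N %/ p'.+1], and [p.+1] divides [p'.+1] by Gauss. The quotient [t] divides
    [N %/ p.+1], so its prime factors are at least [p], and [p'.+1 >= p * p.+1]. *)
Lemma drop_prime_sqr N p p' : 0 < N -> 2 < p -> p < p' ->
  drop_prime N p -> drop_prime N p' -> p ^ 2 <= p'.
Proof.
move=> N0 p2 ltpp' /drop_primeP[pp /dvdnP[d dE] rough] /drop_primeP[pp' /dvdnP[d' dE'] rough'].
move: rough rough'; rewrite {1}dE dE' !mulnK // => rough rough'.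
have small q : prime q -> q %| p.+1 -> q < p.
  move=> qp qd; have oddp : odd p by case: (even_prime pp); lia.
  have [->|q2] := eqVneq q 2; first lia.
  have q1 := prime_gt1 qp.
  have: q %| p.+1./2.
    have : q %| p.+1./2 * 2 by rewrite muln2 even_halfK //= oddp.
    by rewrite Euclid_dvdM // => /orP[//|]; rewrite dvdn_prime2 // (negPf q2).
  by move/dvdn_leq => /(_ ltac:(lia)); lia.
have cop : coprime p.+1 d'.
  rewrite coprime_has_primes //; last by case: d' dE' {rough'} => //; lia.
  apply/hasPn => q; rewrite !mem_primes => /and3P[qp d'0 qd'].
  apply/negP => /and3P[_ _ qd].
  by move: (rough' _ qp (ltn_trans (small _ qp qd) ltpp')); rewrite qd'.
have /dvdnP[t tE] : p.+1 %| p'.+1.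
  by rewrite -(Gauss_dvdr _ cop) -dE' dE dvdn_mull.
have dt : d = d' * t by apply/eqP; rewrite -(@eqn_pmul2r p.+1) //; nia.
have t1 : 1 < t by case: t tE {dt} => [|[|t]]; lia.
have : p <= pdiv t.
  rewrite leqNgt; apply/negP=> lt; have /negP := rough _ (pdiv_prime t1) lt; apply.
  by rewrite dt dvdn_mull // pdiv_dvd.
have := pdiv_leq (ltnW t1); nia.
Qed.

(* By [drop_prime_sqr], p -> log2 log2 p is injective on the odd primes of [drops N]. *)
Lemma size_drops N : 0 < N ->
  size (drops N) <= (trunc_log 2 (trunc_log 2 N)).+2.
Proof.
move=> N0; set L := trunc_log 2 _.
have -> : size (drops N) = count (fun p => p <= 2) (drops N) + count (fun p => 2 < p) (drops N).
  rewrite -(count_predC (fun p => p <= 2)); congr addn.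
  by apply: eq_count => p /=; rewrite ltnNge.
have c1 : count (fun p => p <= 2) (drops N) <= 1.
  rewrite -size_filter; apply: (@uniq_leq_size _ _ [:: 2]).
    by rewrite !filter_uniq ?iota_uniq.
  move=> p; rewrite mem_filter mem_drops // inE => /andP[le2 /drop_primeP[/prime_gt1]]; lia.
suff: count (fun p => 2 < p) (drops N) <= L.+1 by lia.
rewrite -size_filter -(size_map (fun p => trunc_log 2 (trunc_log 2 p))) -(size_iota 0 L.+1).
apply: uniq_leq_size.
  rewrite map_inj_in_uniq ?filter_uniq ?iota_uniq // => p p'.
  rewrite !mem_filter => /andP[p2]; rewrite -mem_filter -/(drops _) mem_drops //.
  move=> dp /andP[p2']; rewrite -mem_filter -/(drops _) mem_drops // => dp'.
  wlog lt : p p' p2 dp p2' dp' / p < p' => [wl|].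
    by case: (ltngtP p p') => // lt eq; [|symmetry]; apply: wl.
  have le := drop_prime_sqr N0 p2 lt dp dp'.
  have : trunc_log 2 (p ^ 2) <= trunc_log 2 p' by apply: leq_trunc_log.
  have lep : 2 * trunc_log 2 p <= trunc_log 2 (p ^ 2).
    apply: trunc_log_max => //; rewrite mulnC expnM leq_exp2r //.
    by apply: trunc_logP => //; lia.
  have l1 : 0 < trunc_log 2 p by rewrite trunc_log_gt0; lia.
  move=> le2 eq.
  have : (trunc_log 2 (trunc_log 2 p)).+1 <= trunc_log 2 (trunc_log 2 p').
    rewrite -trunc_log2_double // -mul2n.
    by apply: leq_trunc_log; lia.
  lia.
move=> l /mapP[p]; rewrite mem_filter => /andP[p2]; rewrite mem_drops //.
case/drop_primeP=> _ /(dvdn_leq N0) le _ ->.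
by rewrite mem_iota /= add0n ltnS; apply: leq_trunc_log; apply: leq_trunc_log; lia.
Qed.

Lemma drops_chain
  (dirichlet : forall a m B, 1 < m -> coprime a m ->
      exists p, [/\ prime p, B < p & p = a %[mod m]]) k B :
  exists p, [/\ prime p, B < p & k < size (drops p.+1)].
Proof.
elim: k => [|k [p [pp ltB ltk]]].
  have [p ltp pp] := prime_above B; exists p; split=> //.
  suff: p \in drops p.+1 by case: drops.
  rewrite mem_drops //; apply/drop_primeP; split=> // q qp _.
  by rewrite divnn /= Euclid_dvd1.
have p1 := prime_gt1 pp.
pose m := p.+1 * p.-1`!.
have m1 : 1 < m by have := fact_gt0 p.-1; rewrite /m; nia.
have cop : coprime p m.
  rewrite coprimeMr coprimenS prime_coprime //=.
  suff H j : j < p -> ~~ (p %| j`!) by apply: H; lia.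
  elim: j => [|j IHj] ltj; first by rewrite fact0 dvdn1; lia.
  rewrite factS Euclid_dvdM // negb_or IHj ?andbT; last by lia.
  by apply/negP => /(dvdn_leq (ltn0Sn _)); lia.
have [p' [pp' ltp' p'E]] := dirichlet p m (maxn B p) m1 cop.
have [c cE] : exists c, p' = p + c * m.
  have /eqP := p'E; rewrite eqn_mod_dvd; last by lia.
  by case/dvdnP=> c cE; exists c; lia.
have tE : p'.+1 = p.+1 * (1 + c * p.-1`!) by rewrite cE /m; nia.
exists p'; split=> //; first by lia.
suff: size (p' :: drops p.+1) <= size (drops p'.+1) by move=> /=; lia.
apply: uniq_leq_size => [|q].
  rewrite /= filter_uniq ?iota_uniq // andbT mem_drops //.
  by apply/negP => /drop_primeP[_ /(dvdn_leq (ltn0Sn _))]; lia.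
rewrite inE !mem_drops // => /orP[/eqP ->|/drop_primeP[qp qd rough]]; apply/drop_primeP.
  by split=> // r rp _; rewrite divnn /= Euclid_dvd1.
split=> // [|r rp ltr]; first by rewrite tE dvdn_mulr.
rewrite tE mulnC -muln_divA // Euclid_dvdM // negb_or rough // andbT.
have ltrp : r < p by have := dvdn_leq (ltn0Sn _) qd; lia.
rewrite dvdn_addl ?Euclid_dvd1 // dvdn_mull // dvdn_fact //.
by have := prime_gt0 rp; lia.
Qed.

(** * Arithmetic functions *)

(** Induction along the factorization, one full prime power at a time: the form suited to
    multiplicative functions. *)
Lemma prime_pow_ind (P : nat -> Prop) :
  P 1 ->
  (forall p a n, prime p -> ~~ (p %| n) -> 0 < n -> P n -> P (p ^ a.+1 * n)) ->
  forall n, 0 < n -> P n.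
Proof.
move=> P1 PS; elim/ltn_ind => n IHn n0.
have [n1|n_gt1] := leqP n 1; first by have -> : n = 1 by lia.
have pp := pdiv_prime n_gt1; set p := pdiv n in pp.
have [n' cop nE] := pfactor_coprime pp n0.
have n'0 : 0 < n' by case: n' nE {cop} => //; lia.
have : 0 < logn p n by rewrite logn_gt0 mem_primes pp n0 pdiv_dvd.
move: nE; case: (logn p n) => // a nE _.
rewrite nE mulnC; apply: PS => //; first by rewrite -prime_coprime.
apply: IHn => //; rewrite nE -[ltnLHS]muln1 ltn_pmul2l //.
by rewrite expnS; have := prime_gt1 pp; have := expn_gt0 p a; nia.
Qed.

Lemma perm_divisors_pow p a n : prime p -> ~~ (p %| n) -> 0 < n ->
  perm_eq (divisors (p ^ a.+1 * n))
    (divisors (p ^ a * n) ++ [seq p ^ a.+1 * d | d <- divisors n]).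
Proof.
move=> pp pn n0; have p0 := prime_gt0 pp.
have pa0 b : 0 < p ^ b by rewrite expn_gt0 p0.
have pan b : 0 < p ^ b * n by rewrite muln_gt0 pa0.
apply: uniq_perm; first exact: divisors_uniq.
  rewrite cat_uniq divisors_uniq map_inj_uniq ?divisors_uniq ?andbT /=; last first.
    by move=> x y /eqP; rewrite eqn_pmul2l // => /eqP.
  apply/hasPn => _ /mapP[d _ ->]; rewrite -dvdn_divisors //.
  apply/negP => /(dvdn_trans (dvdn_mulr _ (dvdnn _))).
  by rewrite expnS mulnC dvdn_pmul2l // (negPf pn).
move=> d; rewrite mem_cat -!dvdn_divisors //; apply/idP/orP => [dvd_d|]; last first.
  case=> [|/mapP[d' d'n ->]]; last by rewrite dvdn_pmul2l // dvdn_divisors.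
  by move/dvdn_trans; apply; rewrite expnS -mulnA dvdn_mull.
have d0 : 0 < d by apply: dvdn_gt0 dvd_d.
have [d' cop dE] := pfactor_coprime pp d0.
have d'n : d' %| n.
  have : d' %| p ^ a.+1 * n by apply: dvdn_trans dvd_d; rewrite dE dvdn_mulr.
  by rewrite Gauss_dvdr // coprime_sym coprimeXl.
have lea : logn p d <= a.+1.
  rewrite -(pfactorK a.+1 pp); have -> : logn p (p ^ a.+1) = logn p (p ^ a.+1 * n).
    by rewrite lognM // [logn p n]logn_coprime ?addn0 // prime_coprime.
  exact: dvdn_leq_log.
have [lea'|gta] := leqP (logn p d) a.
  by left; rewrite dE mulnC dvdn_mul // dvdn_exp2l.
right; apply/mapP; exists d'; rewrite -?dvdn_divisors //.
by rewrite {1}dE mulnC; congr (p ^ _ * _); lia.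
Qed.

Local Open Scope ring_scope.

Lemma sum_divisors_pow (V : nmodType) p a n (F : nat -> V) :
  prime p -> ~~ (p %| n)%N -> (0 < n)%N ->
  \sum_(d <- divisors (p ^ a * n)) F d =
  \sum_(i < a.+1) \sum_(d <- divisors n) F (p ^ i * d)%N.
Proof.
move=> pp pn n0; elim: a => [|a IHa].
  by rewrite big_ord1 mul1n; apply: eq_bigr => d _; rewrite mul1n.
by rewrite (perm_big _ (perm_divisors_pow _ pp pn n0)) big_cat /= IHa big_map [RHS]big_ord_recr.
Qed.

Lemma sum_dvd_range (V : nmodType) d x (H : nat -> V) : (0 < d)%N ->
  \sum_(1 <= n < x.+1 | (d %| n)%N) H n = \sum_(1 <= k < (x %/ d).+1) H (d * k)%N.
Proof.
move=> d0; rewrite -big_filter -[RHS](big_map (muln d) xpredT H).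
apply: perm_big; apply: uniq_perm; first by rewrite filter_uniq ?iota_uniq.
  by rewrite map_inj_uniq ?iota_uniq // => u v /eqP; rewrite eqn_pmul2l // => /eqP.
move=> n; rewrite mem_filter mem_index_iota; apply/idP/mapP.
  case/and3P=> /dvdnP[k ->] n0 nx; exists k; rewrite 1?mulnC // mem_index_iota.
  by rewrite ltnS leq_divRL //; nia.
case=> k; rewrite mem_index_iota ltnS leq_divRL // => /andP[k0 kx] ->.
by rewrite dvdn_mulr // ltnS; nia.
Qed.

Lemma exchange_divisors (V : nmodType) x (G : nat -> nat -> V) :
  \sum_(1 <= n < x.+1) \sum_(d <- divisors n) G n d =
  \sum_(1 <= d < x.+1) \sum_(1 <= k < (x %/ d).+1) G (d * k)%N d.
Proof.
transitivity (\sum_(1 <= n < x.+1) \sum_(1 <= d < x.+1 | (d %| n)%N) G n d).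
  rewrite !big_nat; apply: eq_bigr => n /andP[n0 nx].
  rewrite -[RHS]big_filter; apply: perm_big; apply: uniq_perm.
  - exact: divisors_uniq.
  - by rewrite filter_uniq ?iota_uniq.
  move=> d; rewrite mem_filter mem_index_iota -dvdn_divisors //.
  by rewrite andb_idr // => dn; rewrite (dvdn_gt0 n0 dn) ltnS; have := dvdn_leq n0 dn; lia.
rewrite (exchange_big_dep_nat xpredT) //= !big_nat; apply: eq_bigr => d /andP[d0 _].
by rewrite sum_dvd_range.
Qed.

Section ArithmeticFunctions.
Variable R : realType.
Implicit Types (n p x : nat).

(* Also covers n = 0, where [ln 0 = 0]. *)
Definition lnn n : R := ln n%:R.

Lemma lnn1 : lnn 1 = 0. Proof. exact: ln1. Qed.

Lemma lnn_ge0 n : 0 <= lnn n.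
Proof. by case: n => [|n]; [rewrite /lnn ln0|rewrite ln_ge0 // ler1n]. Qed.

Lemma lnnM m n : (0 < m)%N -> (0 < n)%N -> lnn (m * n) = lnn m + lnn n.
Proof. by move=> m0 n0; rewrite /lnn natrM lnM // posrE ltr0n. Qed.

Lemma lnnX m k : (0 < m)%N -> lnn (m ^ k) = lnn m *+ k.
Proof. by move=> m0; rewrite /lnn natrX lnXn // ltr0n. Qed.

Lemma le_lnn m n : (0 < m)%N -> (m <= n)%N -> lnn m <= lnn n.
Proof. by move=> m0 mn; rewrite /lnn ler_ln ?posrE ?ler_nat ?ltr0n //; lia. Qed.

Lemma lnnS n : (0 < n)%N -> lnn n.+1 <= lnn n + n%:R^-1.
Proof.
move=> n0; have n0' : 0 < n%:R :> R by rewrite ltr0n.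
rewrite /lnn; have -> : n.+1%:R = n%:R * (1 + n%:R^-1) :> R.
  by rewrite mulrDr divff ?gt_eqF // mulr1 natr1.
have i0 : 0 < n%:R^-1 :> R by rewrite invr_gt0.
have i1 : 0 < 1 + n%:R^-1 :> R by lra.
rewrite lnM ?posrE //.
by rewrite lerD2l le_ln1Dx //; lra.
Qed.

Lemma lnn2_ge : 1 / 2 <= lnn 2.
Proof.
have h : -1 < - (1 / 2) :> R by lra.
have := le_ln1Dx h; have -> : 1 - 1 / 2 = 2^-1 :> R by field.
by rewrite lnV ?posrE // -/(lnn 2); lra.
Qed.

Lemma lnn2_le : lnn 2 <= 1.
Proof. by have := lnnS (isT : 0 < 1)%N; rewrite lnn1 invr1; lra. Qed.

Lemma lnn_unbounded (K : R) : exists n, (0 < n)%N /\ K < lnn n.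
Proof.
have l2 : 0 < lnn 2 by rewrite /lnn ln_gt0 // ltr1n.
have [k] : exists k : nat, K / lnn 2 < k%:R.
  exists (Num.bound `|K / lnn 2|); apply: le_lt_trans (ler_norm _) _.
  exact: archi_boundP.
rewrite ltr_pdivrMr // => lt; exists (2 ^ k)%N; rewrite expn_gt0; split=> //.
by rewrite lnnX // -mulr_natl.
Qed.

Definition mangoldt n : R := if size (primes n) == 1%N then lnn (pdiv n) else 0.

Lemma mangoldt_ge0 n : 0 <= mangoldt n.
Proof. by rewrite /mangoldt; case: ifP => // _; exact: lnn_ge0. Qed.

Lemma mangoldt_pow p k : prime p -> mangoldt (p ^ k.+1) = lnn p.
Proof. by move=> pp; rewrite /mangoldt primesX // primes_prime //= pdiv_pfactor. Qed.

Lemma mangoldt_neq0 n : mangoldt n != 0 -> exists p k, prime p /\ n = (p ^ k.+1)%N.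
Proof.
rewrite /mangoldt; case: ifP => [/eqP sz _|]; last by rewrite eqxx.
case: n sz => // n sz.
have [p pE] : exists p, primes n.+1 = [:: p] by case: primes sz => [|p []] // _; exists p.
have := pE; have : p \in primes n.+1 by rewrite pE inE.
rewrite mem_primes => /and3P[pp _ pn] _.
have l0 : (0 < logn p n.+1)%N by rewrite logn_gt0 pE inE.
exists p, (logn p n.+1).-1; split=> //; rewrite prednK //.
by rewrite {1}(prod_prime_decomp (ltn0Sn n)) prime_decompE pE /= big_seq1.
Qed.

Lemma mangoldt_pow_mul p k d : prime p -> ~~ (p %| d)%N -> (0 < d)%N ->
  mangoldt (p ^ k.+1 * d) = if d == 1%N then lnn p else 0.
Proof.
move=> pp pd d0; case: eqP => [->|/eqP d1]; first by rewrite muln1 mangoldt_pow.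
apply/eqP/negPn/negP => /mangoldt_neq0[q [j [qp qE]]].
have pq : p = q.
  have : (p %| q ^ j.+1)%N by rewrite -qE expnS -mulnA dvdn_mulr.
  by rewrite Euclid_dvdX // andbT dvdn_prime2 // => /eqP.
have d_gt1 : (1 < d)%N by lia.
have : pdiv d = q.
  have : (pdiv d %| q ^ j.+1)%N by rewrite -qE dvdn_mull // pdiv_dvd.
  by rewrite Euclid_dvdX ?pdiv_prime // andbT dvdn_prime2 ?pdiv_prime // => /eqP.
by move=> dE; move: pd; rewrite pq -dE pdiv_dvd.
Qed.

Lemma divisors1 : divisors 1 = [:: 1%N]. Proof. by []. Qed.

Lemma sum_mangoldt n : (0 < n)%N -> \sum_(d <- divisors n) mangoldt d = lnn n.
Proof.
move: n; apply: prime_pow_ind => [|p a n pp pn n0 IH].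
  by rewrite divisors1 big_seq1 /mangoldt /= lnn1.
have p0 := prime_gt0 pp.
rewrite sum_divisors_pow // big_ord_recl lnnM ?expn_gt0 ?p0 // lnnX // addrC.
congr +%R; last by rewrite -IH; apply: eq_bigr => d _; rewrite mul1n.
rewrite -[in RHS](card_ord a.+1) -sumr_const; apply: eq_bigr => i _.
rewrite (bigD1_seq 1%N) ?divisor1 ?divisors_uniq //=.
have -> : mangoldt (p ^ bump 0 i * 1) = lnn p.
  by rewrite mangoldt_pow_mul // dvdn1; have := prime_gt1 pp; lia.
rewrite big_seq_cond big1 ?addr0 //.
move=> d /andP[dn d1]; rewrite -dvdn_divisors // in dn.
rewrite mangoldt_pow_mul ?(negPf d1) //; last exact: dvdn_gt0 dn.
by apply: contra pn => /dvdn_trans; apply.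
Qed.

Definition moebius n : R := \prod_(p <- primes n) (if logn p n == 1%N then -1 else 0).

Lemma moebius_pow_mul p a n : prime p -> ~~ (p %| n)%N -> (0 < n)%N ->
  moebius (p ^ a.+1 * n) = (if a == 0%N then -1 else 0) * moebius n.
Proof.
move=> pp pn n0; have p0 := prime_gt0 pp.
have pE : perm_eq (primes (p ^ a.+1 * n)) (p :: primes n).
  apply: uniq_perm; rewrite /= ?primes_uniq // ?andbT.
    by rewrite mem_primes (negPf pn) !andbF.
  by move=> q; rewrite primesM ?expn_gt0 ?p0 // primesX // primes_prime // !inE.
rewrite /moebius (perm_big _ pE) big_cons; congr *%R.
  rewrite lognM ?expn_gt0 ?p0 // pfactorK // [logn p n]logn_coprime ?addn0 // prime_coprime //.
rewrite big_seq [RHS]big_seq; apply: eq_bigr => q; rewrite mem_primes => /and3P[qp _ qn].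
rewrite lognM ?expn_gt0 ?p0 // lognX logn_prime //.
have -> : (q == p) = false by apply: contraNF pn => /eqP <-.
by rewrite muln0.
Qed.

Lemma sum_moebius n : (0 < n)%N ->
  \sum_(d <- divisors n) moebius d = if n == 1%N then 1 else 0.
Proof.
move: n; apply: prime_pow_ind => [|p a n pp pn n0 _].
  by rewrite divisors1 big_seq1 /moebius big_nil.
have -> : (p ^ a.+1 * n == 1)%N = false.
  apply/eqP => E; have : (p %| 1)%N by rewrite -E expnS -mulnA dvdn_mulr.
  by rewrite Euclid_dvd1.
have dP d : d \in divisors n -> ~~ (p %| d)%N /\ (0 < d)%N.
  rewrite -dvdn_divisors // => dn; split; last exact: dvdn_gt0 dn.
  by apply: contra pn => /dvdn_trans; apply.
rewrite sum_divisors_pow // !big_ord_recl /= [X in _ + (_ + X)]big1 => [|i _]; last first.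
  by rewrite big_seq big1 // => d /dP[pd d0]; rewrite moebius_pow_mul // mul0r.
rewrite addr0 -big_split /= big_seq big1 // => d /dP[pd d0].
by rewrite moebius_pow_mul // mul1n /= mulN1r subrr.
Qed.

(** Only the divisors [d] and [p * d], with [d] prime to [p], have a nonzero term. The two terms add
    up to [- lnn p * moebius d], and the sum of [moebius] vanishes unless the part prime to [p] is
    1. *)
Lemma sum_moebius_ln n : (0 < n)%N ->
  \sum_(d <- divisors n) moebius d * lnn d = - mangoldt n.
Proof.
move: n; apply: prime_pow_ind => [|p a n pp pn n0 _].
  by rewrite divisors1 big_seq1 lnn1 mulr0 /mangoldt /= oppr0.
have p0 := prime_gt0 pp.
have dP d : d \in divisors n -> ~~ (p %| d)%N /\ (0 < d)%N.
  rewrite -dvdn_divisors // => dn; split; last exact: dvdn_gt0 dn.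
  by apply: contra pn => /dvdn_trans; apply.
rewrite sum_divisors_pow // !big_ord_recl /= [X in _ + (_ + X)]big1 => [|i _]; last first.
  by rewrite big_seq big1 // => d /dP[pd d0]; rewrite moebius_pow_mul // !mul0r.
rewrite addr0 -big_split /= mangoldt_pow_mul //.
rewrite big_seq (eq_bigr (fun d => - lnn p * moebius d)) => [|d /dP[pd d0]].
  rewrite -big_seq -mulr_sumr sum_moebius //.
  by case: ifP; rewrite ?mulr1 ?mulr0 ?oppr0.
by rewrite moebius_pow_mul // mul1n expn1 lnnM //=; ring.
Qed.

Lemma norm_moebius n : `|moebius n| <= 1.
Proof.
rewrite /moebius; elim/big_ind: _ => [|x y hx hy|p _]; first by rewrite normr1.
  by rewrite normrM mulr_ile1.
by case: ifP; rewrite ?normrN ?normr1 ?normr0.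
Qed.

End ArithmeticFunctions.

(** * Chebyshev and Mertens estimates *)

Section MertensEstimates.
Variable R : realType.
Implicit Types (n p x : nat).
Local Notation lnn := (@lnn R).
Local Notation mangoldt := (@mangoldt R).

Lemma sum_lnn_ge x : x%:R * lnn x - x%:R <= \sum_(1 <= n < x.+1) lnn n.
Proof.
elim: x => [|x IHx]; first by rewrite big_geq //; lra.
rewrite big_nat_recr //=; case: x IHx => [|x] IHx.
  by rewrite big_geq // lnn1; lra.
set a := lnn x.+2; set b := lnn x.+1 in IHx; set y : R := x.+1%:R in IHx.
have y0 : 0 < y by rewrite ltr0n.
have h : y * a <= y * b + 1.
  by rewrite -[1](divff (lt0r_neq0 y0)) -mulrDr ler_pM2l // lnnS.
rewrite -natr1 -/y; lra.
Qed.

Lemma sum_lnn_le x : \sum_(1 <= n < x.+1) lnn n <= x%:R * lnn x.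
Proof.
rewrite [leRHS](_ : _ = \sum_(1 <= n < x.+1) lnn x); last first.
  by rewrite sumr_const_nat subn1 mulr_natl.
by apply: ler_sum_nat => n /andP[n0 nx]; apply: le_lnn.
Qed.

Lemma sum_ln_ratio x : \sum_(1 <= n < x.+1) (lnn x - lnn n) <= x%:R.
Proof.
rewrite sumrB sumr_const_nat subn1 -mulr_natl.
by have := sum_lnn_ge x; lra.
Qed.

(** Legendre's formula for the logarithm of the factorial of [x]. *)
Lemma sum_lnn_mangoldt x :
  \sum_(1 <= n < x.+1) lnn n = \sum_(1 <= d < x.+1) mangoldt d * (x %/ d)%:R.
Proof.
transitivity (\sum_(1 <= n < x.+1) \sum_(d <- divisors n) mangoldt d).
  by rewrite !big_nat; apply: eq_bigr => n /andP[n0 _]; rewrite sum_mangoldt.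
rewrite exchange_divisors; apply: eq_bigr => d _.
by rewrite sumr_const_nat subn1 mulr_natr.
Qed.

Definition psi x : R := \sum_(1 <= d < x.+1) mangoldt d.

Lemma le_psi : {homo psi : x y / (x <= y)%N >-> x <= y}.
Proof.
move=> x y xy; rewrite /psi [leRHS](big_cat_nat (n := x.+1)) //= lerDl.
by apply: sumr_ge0 => d _; apply: mangoldt_ge0.
Qed.

(* Chebyshev: T(2n) - 2 T(n), with T(x) = ln x!, bounds psi(2n) - psi(n) from above. *)
Lemma psi_double n : psi (n + n) <= psi n + 4 * n%:R.
Proof.
case: n => [|n']; first by rewrite /psi !big_geq //; lra.
set n := n'.+1.
have extend (F : nat -> R) : \sum_(1 <= d < n.+1) F d =
    \sum_(1 <= d < (n + n).+1) F d * (d <= n)%:R.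
  rewrite [RHS](big_cat_nat (n := n.+1)) //=; last by lia.
  rewrite [X in _ = _ + X]big_nat [X in _ = _ + X]big1 ?addr0 => [|d /andP[nd _]]; last first.
    by rewrite leqNgt nd mulr0.
  rewrite !big_nat; apply: eq_bigr => d /andP[_ dn].
  by rewrite -ltnS dn mulr1.
have key : psi (n + n) - psi n <=
    \sum_(1 <= k < (n + n).+1) lnn k - 2 * \sum_(1 <= k < n.+1) lnn k.
  rewrite !sum_lnn_mangoldt /psi !extend mulr_sumr -!sumrB.
  apply: ler_sum_nat => d /andP[d0 dn].
  have m0 := mangoldt_ge0 R d.
  rewrite -{1}[mangoldt d]mulr1 -mulrBr mulrCA -!mulrA -mulrBr ler_wpM2l //.
  rewrite lerBrDr -natrM -natrM.
  (* The coefficient of [mangoldt d] in T(2n) - 2 T(n) is nonnegative, and at least 1 when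
     [n < d <= n + n]. *)
  case: leqP => [dn'|nd]; rewrite ?subrr ?add0r ?subr0 ?muln1 ?muln0 ?addr0.
    rewrite ler_nat leq_divRL // -mulnA; have := leq_divM n d; lia.
  by rewrite ler1n divn_gt0 //; lia.
have l2 := lnn2_le R.
have lnE : lnn (n + n) = lnn 2 + lnn n by rewrite addnn -mul2n lnnM.
have n0 : 0 <= n%:R :> R by rewrite ler0n.
have := sum_lnn_ge n; have := sum_lnn_le (n + n); have := ler_wpM2l n0 l2.
rewrite lnE natrD; lra.
Qed.

Lemma psi_le x : psi x <= 12 * x%:R.
Proof.
elim/ltn_ind: x => x IHx.
have [x1|x1] := leqP x 1.
  have := ler0n R x; suff -> : psi x = 0 by lra.
  case: x x1 {IHx} => [|[|//]] _; first by rewrite /psi big_geq.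
  by rewrite /psi big_nat1 /mangoldt.
have le1 : psi x <= psi (uphalf x + uphalf x) by apply: le_psi; lia.
have le2 := psi_double (uphalf x).
have le3 : psi (uphalf x) <= 12 * (uphalf x)%:R by apply: IHx; lia.
(* The factor 16 is 12 from the induction plus 4 from the doubling step; the constant 12 absorbs the
   rounding because [uphalf x] is at most [3 * x / 4] for [x >= 2]. *)
have : (16 * uphalf x)%:R <= (12 * x)%:R :> R by rewrite ler_nat; lia.
rewrite !natrM; lra.
Qed.

(** Dropping the integer parts in Legendre's formula costs at most 1 per [mangoldt d], so [x%:R * M]
    exceeds the log of the factorial by between 0 and [psi x]. That log lies between [x * ln x - x]
    and [x * ln x]. *)
Lemma mertens x : (0 < x)%N ->
  `|\sum_(1 <= d < x.+1) mangoldt d / d%:R - lnn x| <= 12.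
Proof.
move=> x0; have x0' : 0 < x%:R :> R by rewrite ltr0n.
set M := \sum_(1 <= d < x.+1) _.
have lo : \sum_(1 <= n < x.+1) lnn n <= x%:R * M.
  rewrite sum_lnn_mangoldt mulr_sumr; apply: ler_sum_nat => d /andP[d0 _].
  have d0' : 0 < d%:R :> R by rewrite ltr0n.
  rewrite mulrCA ler_wpM2l ?mangoldt_ge0 // ler_pdivlMr // -natrM ler_nat.
  exact: leq_divM.
have up : x%:R * M <= \sum_(1 <= n < x.+1) lnn n + psi x.
  rewrite sum_lnn_mangoldt mulr_sumr -big_split /=; apply: ler_sum_nat => d /andP[d0 _].
  have d0' : 0 < d%:R :> R by rewrite ltr0n.
  rewrite mulrCA -[X in _ + X]mulr1 -mulrDr ler_wpM2l ?mangoldt_ge0 //.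
  rewrite ler_pdivrMr // natr1 -natrM ler_nat.
  by rewrite -ltnS mulnC ltnS; have := ltn_ceil x d0; rewrite mulnC; lia.
have := sum_lnn_ge x; have := sum_lnn_le x; have := psi_le x => h1 h2 h3.
rewrite ler_norml -(ler_pM2l x0') -[X in _ && X](ler_pM2l x0') mulrBr.
apply/andP; split; lra.
Qed.

(** Summation by parts of [ln n * (1 / (n - 1) - 1 / n)], with [ln n.+1 - ln n <= 1 / n]. The
    negative terms on the right carry the induction. *)
Lemma sum_lnn_telescope x :
  \sum_(2 <= n < x.+2) lnn n / (n%:R * (n.-1)%:R) <=
    lnn 2 + 1 - lnn x.+2 / x.+1%:R - x.+1%:R^-1.
Proof.
elim: x => [|x IHx]; first by rewrite big_geq // divr1 invr1; lra.
rewrite big_nat_recr //= (le_trans (lerD IHx (lexx _))) //.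
have h := lnnS R (isT : 0 < x.+2)%N.
move: h; set a := lnn x.+2; set b := lnn x.+3.
have y0 : 0 < x.+1%:R :> R by rewrite ltr0n.
have -> : x.+2%:R = x.+1%:R + 1 :> R by rewrite natr1.
set y : R := x.+1%:R in y0 *; clearbody y.
have y1 : 0 < y + 1 by lra.
move=> h.
rewrite -subr_ge0.
have -> : lnn 2 + 1 - b / (y + 1) - (y + 1)^-1 -
   (lnn 2 + 1 - a / y - y^-1 + a / ((y + 1) * y)) =
   ((a + (y + 1)^-1 - b) * y + (y + 1)^-1) / ((y + 1) * y).
  by field; rewrite !gt_eqF.
apply: divr_ge0; last by rewrite mulr_ge0; lra.
have : 0 <= (a + (y + 1)^-1 - b) * y by apply: mulr_ge0; lra.
have : 0 <= (y + 1)^-1 by rewrite invr_ge0; lra.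
lra.
Qed.

Lemma sum_inv_pow p K : (1 < p)%N ->
  \sum_(2 <= k < K) (p ^ k)%:R^-1 <= (p%:R * (p.-1)%:R)^-1 :> R.
Proof.
move=> p1; have p0 : 0 < p%:R :> R by rewrite ltr0n; lia.
have q0 : 0 < p.-1%:R :> R by rewrite ltr0n; lia.
have pq : p%:R = p.-1%:R + 1 :> R by rewrite natr1 prednK //; lia.
have i0 : 0 <= (p%:R * p.-1%:R)^-1 :> R by rewrite invr_ge0 mulr_ge0 ?ler0n.
have [K2|K2] := leqP K 2; first by rewrite big_geq.
have -> : K = K.-2.+2 by lia.
suff : \sum_(2 <= k < K.-2.+2) (p ^ k)%:R^-1 =
    (p%:R * p.-1%:R)^-1 - ((p ^ K.-2.+1)%:R * p.-1%:R)^-1 :> R.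
  have : 0 <= ((p ^ K.-2.+1)%:R * p.-1%:R)^-1 :> R.
    by rewrite invr_ge0 mulr_ge0 ?ler0n.
  by lra.
elim: (K.-2) => [|k IH]; first by rewrite big_geq // expn1 subrr.
rewrite big_nat_recr //= IH (expnS p k.+1) natrM.
have u0 : 0 < (p ^ k.+1)%:R :> R by rewrite ltr0n expn_gt0; lia.
move: p0 q0 pq u0 {IH}; move: (p%:R : R) (p.-1%:R : R) ((p ^ k.+1)%:R : R).
move=> a b u a0 b0 -> u0; field.
by rewrite !gt_eqF //; lra.
Qed.

(** Only the powers [p ^ k] with [k >= 2] contribute. Letting [p] range over all integers from 2 on,
    the geometric series gives terms [ln p / (p * (p - 1))], of total at most [ln 2 + 1]. *)
Lemma sum_mangoldt_nonprime x :
  \sum_(1 <= n < x.+1 | ~~ prime n) mangoldt n / n%:R <= 2.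
Proof.
have le1 : \sum_(1 <= n < x.+1 | ~~ prime n) mangoldt n / n%:R <=
   \sum_(1 <= n < x.+1) \sum_(2 <= p < x.+2) \sum_(2 <= k < x.+1 | (p ^ k == n)%N)
      lnn p / (p ^ k)%:R.
  rewrite [leLHS]big_mkcond; apply: ler_sum_nat => n /andP[n0 nx].
  have ge0 p : 0 <= \sum_(2 <= k < x.+1 | (p ^ k == n)%N) lnn p / (p ^ k)%:R.
    by apply: sumr_ge0 => k _; rewrite divr_ge0 ?lnn_ge0.
  case: ifP => [np|_]; last by apply: sumr_ge0 => p _; apply: ge0.
  have [->|/mangoldt_neq0[p [k [pp nE]]]] := eqVneq (mangoldt n) 0.
    by rewrite mul0r; apply: sumr_ge0 => p _; apply: ge0.
  have p1 := prime_gt1 pp.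
  have ltk : (k.+1 < p ^ k.+1)%N by apply: ltn_expl.
  have ltp : (p <= p ^ k.+1)%N by rewrite expnS leq_pmulr // expn_gt0; lia.
  have k0 : (0 < k)%N.
    by case: k nE {ltk ltp} => // nE; rewrite nE expn1 pp in np.
  rewrite (bigD1_seq p) ?iota_uniq ?mem_index_iota //=; last by lia.
  rewrite [X in _ <= X + _]big_mkcond (bigD1_seq k.+1) ?iota_uniq ?mem_index_iota //=; last by lia.
  rewrite nE eqxx mangoldt_pow // -addrA lerDl addr_ge0 //.
    by apply: sumr_ge0 => j _; case: ifP => // _; rewrite divr_ge0 ?lnn_ge0.
  by apply: sumr_ge0 => q _; rewrite -nE ge0.
apply: le_trans le1 _; rewrite exchange_big_nat /=.
have l2 := lnn2_le R.
apply: (@le_trans _ _ (\sum_(2 <= p < x.+2) lnn p / (p%:R * p.-1%:R))); last first.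
  apply: le_trans (sum_lnn_telescope x) _.
  have u0 : 0 <= lnn x.+2 / x.+1%:R by rewrite divr_ge0 ?lnn_ge0.
  have v0 : 0 <= x.+1%:R^-1 :> R by rewrite invr_ge0.
  move: u0 v0; set u := lnn x.+2 / _; set v := _^-1; clearbody u v => u0 v0.
  by lra.
apply: ler_sum_nat => p /andP[p2 _].
rewrite (exchange_big_dep_nat xpredT) //=.
apply: (@le_trans _ _ (\sum_(2 <= k < x.+1) lnn p / (p ^ k)%:R)); last first.
  by rewrite -mulr_sumr ler_wpM2l ?lnn_ge0 // sum_inv_pow.
apply: ler_sum_nat => k _; rewrite -big_filter.
set t := lnn p / _; have t0 : 0 <= t by rewrite divr_ge0 ?lnn_ge0.
have -> : \sum_(i <- [seq n <- index_iota 1 x.+1 | (p ^ k)%N == n]) t =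
  t *+ count (pred1 (p ^ k)%N) (index_iota 1 x.+1).
  rewrite big_const_seq iter_addr_0 count_filter; congr (_ *+ _).
  by apply: eq_count => n /=; rewrite eq_sym.
have : (count (pred1 (p ^ k)%N) (index_iota 1 x.+1) <= 1)%N.
  by rewrite count_uniq_mem ?iota_uniq ?leq_b1.
by case: count => [|[|//]] _; rewrite ?mulr0n ?mulr1n.
Qed.

End MertensEstimates.

Local Open Scope complex_scope.

(** * Sums of characters *)

Section ComplexNorm.
Variable R : realType.
Local Notation normc := (@Normc.normc R).

Lemma normc_real (r : R) : normc r%:C = `|r|.
Proof. by rewrite /Normc.normc /= expr0n addr0 sqrtr_sqr. Qed.

Lemma normc_ge0 (z : R[i]) : 0 <= normc z.
Proof. by case: z => a b /=; rewrite sqrtr_ge0. Qed.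

Lemma normcB (z w : R[i]) : normc (z - w) = normc (w - z).
Proof. by rewrite -opprB normcN. Qed.

Lemma normc_sum (I : Type) (r : seq I) (P : pred I) (F : I -> R[i]) :
  normc (\sum_(i <- r | P i) F i) <= \sum_(i <- r | P i) normc (F i).
Proof.
elim/big_rec2: _ => [|i y x _ le]; first by rewrite Normc.normc0.
by apply: le_trans (le_normcD _ _) _; rewrite lerD2l.
Qed.

Lemma normc_sub_ge (z w : R[i]) : normc z - normc w <= normc (z + w).
Proof. by have := le_normcD (z + w) (- w); rewrite addrK normcN; lra. Qed.

End ComplexNorm.

Section BoundedCharacterSums.
Variables (R : realType) (chi : nat -> R[i]) (B : R).
Local Notation normc := (@Normc.normc R).
Hypothesis chi_bounded : forall a b, normc (\sum_(a <= n < b) chi n) <= B.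

Lemma abel_summation (f : nat -> R) (S : nat -> R[i]) a k : S a = 0 ->
  (forall n, (a <= n)%N -> S n.+1 = S n + chi n) ->
  \sum_(a <= n < a + k) chi n * (f n)%:C =
  S (a + k)%N * (f (a + k)%N)%:C +
    \sum_(a <= n < a + k) S n.+1 * (f n - f n.+1)%:C.
Proof.
move=> Sa SS; elim: k => [|k IHk].
  by rewrite addn0 !big_geq // Sa mul0r addr0.
rewrite addnS !big_nat_recr ?leq_addr //= IHk SS ?leq_addr // rmorphB /=; ring.
Qed.

Lemma abel_bound (f : nat -> R) a b :
  (forall n, (a <= n)%N -> 0 <= f n) -> (forall n, (a <= n)%N -> f n.+1 <= f n) ->
  normc (\sum_(a <= n < b) chi n * (f n)%:C) <= B * f a.
Proof.
move=> f0 fdec.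
have B0 : 0 <= B by have := chi_bounded 0 0; rewrite big_geq // Normc.normc0.
have [ba|ab] := leqP b a; first by rewrite big_geq // Normc.normc0 mulr_ge0 ?f0.
rewrite -(subnKC (ltnW ab)); set k := (b - a)%N.
pose S b := \sum_(a <= n < b) chi n.
rewrite (@abel_summation f S); last 2 first.
- by rewrite /S big_geq.
- by move=> n an; rewrite /S big_nat_recr.
apply: le_trans (le_normcD _ _) _.
rewrite Normc.normcM normc_real ger0_norm ?f0 ?leq_addr //.
have le1 : normc (\sum_(a <= n < a + k) S n.+1 * (f n - f n.+1)%:C) <=
    B * (f a - f (a + k)%N).
  apply: le_trans (normc_sum _ _ _) _.
  have -> : f a - f (a + k)%N = \sum_(a <= n < a + k) (f n - f n.+1).
    by rewrite -[RHS]opprK -sumrN (eq_bigr (fun n => f n.+1 - f n)) ?telescope_sumr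
      ?leq_addr ?opprB // => n _; rewrite opprB.
  rewrite mulr_sumr; apply: ler_sum_nat => n /andP[an _].
  rewrite Normc.normcM normc_real ger0_norm ?subr_ge0 ?fdec //.
  by rewrite ler_wpM2r ?subr_ge0 ?fdec //; apply: chi_bounded.
have le2 : normc (S (a + k)%N) * f (a + k)%N <= B * f (a + k)%N.
  by rewrite ler_wpM2r ?f0 ?leq_addr //; apply: chi_bounded.
lra.
Qed.

(** Partial sum of the series for L(1, chi). *)
Definition Lsum N : R[i] := \sum_(1 <= n < N.+1) chi n * (n%:R^-1)%:C.

Lemma Lsum_tail M N : (N <= M)%N -> normc (Lsum M - Lsum N) <= B / N.+1%:R.
Proof.
move=> NM; rewrite /Lsum (big_cat_nat (n := N.+1)) //= addrAC subrr add0r.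
apply: (@abel_bound (fun n => n%:R^-1)) => n Nn; first by rewrite invr_ge0.
by rewrite lef_pV2 ?posrE ?ltr0n ?ler_nat //; lia.
Qed.

Lemma sum_chi_ln : exists K : R, forall x,
  normc (\sum_(1 <= n < x.+1) chi n * (lnn R n / n%:R)%:C) <= K.
Proof.
pose f n := lnn R n / n%:R.
have f0 n : 0 <= f n by rewrite divr_ge0 ?lnn_ge0.
(* [ln n / n] decreases as soon as [ln n >= 1]. The threshold 4 is convenient because
   [ln 4 = 2 * ln 2]; the terms below it are bounded one by one. *)
have ln4 n : (4 <= n)%N -> 1 <= lnn R n.
  move=> n4; apply: (@le_trans _ _ (lnn R 4)); last exact: le_lnn.
  have := lnn2_ge R.
  by rewrite -[4%N]/(2 * 2)%N lnnM //; lra.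
have fdec n : (4 <= n)%N -> f n.+1 <= f n.
  move=> n4; have n0 : 0 < n%:R :> R by rewrite ltr0n; lia.
  rewrite /f ler_pdivrMr ?ltr0n // mulrAC ler_pdivlMr // -natr1 mulrDr mulr1.
  have := ln4 n n4; have : lnn R n.+1 * n%:R <= lnn R n * n%:R + 1.
    rewrite -[X in _ + X](@mulVf _ (n%:R : R)) ?gt_eqF // -mulrDl ler_pM2r //.
    by apply: lnnS; lia.
  by lra.
exists (\sum_(1 <= n < 4) normc (chi n) * f n + B * f 4%N) => x.
have Bf : 0 <= B * f 4%N.
  by rewrite mulr_ge0 //; have := chi_bounded 0 0; rewrite big_geq // Normc.normc0.
have le1 b : normc (\sum_(1 <= n < b) chi n * (f n)%:C) <= \sum_(1 <= n < b) normc (chi n) * f n.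
  apply: le_trans (normc_sum _ _ _) _; apply: ler_sum => n _.
  by rewrite Normc.normcM normc_real ger0_norm.
have [x3|x3] := leqP 3 x.
  rewrite (big_cat_nat (n := 4)) //=; apply: le_trans (le_normcD _ _) _.
  by rewrite lerD //; apply: (@abel_bound f).
apply: le_trans (le1 _) _; rewrite [X in _ <= X + _](big_cat_nat (n := x.+1)) //=; last by lia.
rewrite -addrA lerDl.
by rewrite addr_ge0 // sumr_ge0 // => n _; rewrite mulr_ge0 ?normc_ge0.
Qed.

Hypothesis chiM : forall a b, chi (a * b)%N = chi a * chi b.
Hypothesis chi1 : chi 1 = 1.
Hypothesis norm_chi : forall n, normc (chi n) <= 1.

Definition Tsum x : R[i] := \sum_(1 <= d < x.+1) chi d * (mangoldt R d / d%:R)%:C.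

(* Equivalent to L(1, chi) = 0 by [Lsum_tail]; this form spares the limit. *)
Definition Lvanish := forall N, normc (Lsum N) <= B / N.+1%:R.

(** Putting [n = d * k], complete multiplicativity turns the sum over [k] into a partial sum of L(1,
    chi). It is applied with [g] the function [mangoldt], and then with a Moebius weight. *)
Lemma chi_convolution (g : nat -> R) x :
  \sum_(1 <= n < x.+1) chi n * ((\sum_(d <- divisors n) g d) / n%:R)%:C =
  \sum_(1 <= d < x.+1) chi d * (g d / d%:R)%:C * Lsum (x %/ d).
Proof.
transitivity (\sum_(1 <= n < x.+1) \sum_(d <- divisors n) chi n * (g d / n%:R)%:C).
  by apply: eq_bigr => n _; rewrite mulr_suml rmorph_sum mulr_sumr.
rewrite exchange_divisors; apply: eq_bigr => d _; rewrite mulr_sumr.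
apply: eq_bigr => k _; rewrite chiM natrM invfM mulrA rmorphM /=; ring.
Qed.

Lemma inv_quot_le x d : (0 < x)%N -> (0 < d)%N ->
  (x %/ d).+1%:R^-1 <= d%:R / x%:R :> R.
Proof.
move=> x0 d0; rewrite -[leLHS]mul1r ler_pdivrMr ?ltr0n // mulrAC ler_pdivlMr ?ltr0n //.
by rewrite mul1r -natrM ler_nat mulnC; have := ltn_ceil x d0; lia.
Qed.

Let B0 : 0 <= B.
Proof. by have := chi_bounded 0 0; rewrite big_geq // Normc.normc0. Qed.

(** With [g] equal to [mangoldt], the convolution is the bounded sum of chi(n) ln n / n. Replacing
    each [Lsum (x %/ d)] by [Lsum x] costs at most [B * psi x / x], so [Tsum x * Lsum x] is
    bounded. *)
Lemma Tsum_nonvanish : ~ Lvanish -> exists (K : R) x0, forall x, (x0 <= x)%N -> normc (Tsum x) <= K.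
Proof.
move=> nv; have [K KP] := sum_chi_ln.
have [N lt] : exists N, B / N.+1%:R < normc (Lsum N).
  apply: contrapT => H; apply: nv => N; rewrite leNgt; apply/negP => lt.
  by apply: H; exists N.
(* The excess over the tail bound at [N] is a positive lower bound for every later partial sum. *)
pose delta := normc (Lsum N) - B / N.+1%:R.
have delta0 : 0 < delta by rewrite subr_gt0.
exists ((K + 12 * B) / delta), N.+1 => x Nx.
have x0 : (0 < x)%N by lia.
have x0' : 0 < x%:R :> R by rewrite ltr0n.
have Lx : delta <= normc (Lsum x).
  have := Lsum_tail (ltnW Nx); rewrite normcB => tail.
  have := normc_sub_ge (Lsum N) (Lsum x - Lsum N); rewrite (addrC (Lsum N)) subrK normcB => ge.
  rewrite /delta; apply: le_trans ge; exact: lerB.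
rewrite ler_pdivlMr //; apply: (@le_trans _ _ (normc (Tsum x) * normc (Lsum x))).
  by rewrite ler_wpM2l ?normc_ge0.
rewrite -Normc.normcM.
pose E := \sum_(1 <= d < x.+1) chi d * (mangoldt R d / d%:R)%:C * (Lsum x - Lsum (x %/ d)).
have -> : Tsum x * Lsum x =
    \sum_(1 <= n < x.+1) chi n * (lnn R n / n%:R)%:C + E.
  have -> : \sum_(1 <= n < x.+1) chi n * (lnn R n / n%:R)%:C =
      \sum_(1 <= n < x.+1) chi n * ((\sum_(d <- divisors n) mangoldt R d) / n%:R)%:C.
    by rewrite !big_nat; apply: eq_bigr => n /andP[n0 _]; rewrite sum_mangoldt.
  rewrite chi_convolution -big_split /= mulr_suml; apply: eq_bigr => d _; ring.
apply: le_trans (le_normcD _ _) _; apply: lerD; first exact: KP.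
apply: le_trans (normc_sum _ _ _) _.
apply: (@le_trans _ _ (\sum_(1 <= d < x.+1) mangoldt R d * (B / x%:R))).
  apply: ler_sum_nat => d /andP[d0 _].
  have d0' : 0 < d%:R :> R by rewrite ltr0n.
  have m0 := mangoldt_ge0 R d.
  rewrite !Normc.normcM normc_real ger0_norm ?divr_ge0 //.
  apply: (@le_trans _ _ (1 * (mangoldt R d / d%:R) * (B * (d%:R / x%:R)))).
    apply: ler_pM; rewrite ?mulr_ge0 ?normc_ge0 ?invr_ge0 //.
      by rewrite ler_wpM2r ?divr_ge0.
    apply: le_trans (Lsum_tail (leq_div _ _)) _.
    by rewrite ler_wpM2l // inv_quot_le.
  by rewrite mul1r le_eqVlt; apply/orP; left; apply/eqP; field; rewrite !gt_eqF.
rewrite -mulr_suml mulrA ler_pdivrMr // mulrC -mulrA mulrCA ler_wpM2l //.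
exact: psi_le.
Qed.

Lemma Tsum_vanish : Lvanish -> forall x, (0 < x)%N -> normc (Tsum x + (lnn R x)%:C) <= B.
Proof.
move=> van x x0; have x0' : 0 < x%:R :> R by rewrite ltr0n.
(* The sum of [g] over the divisors of [n] is [mangoldt n], plus [lnn R x] when [n = 1]. As each
   [Lsum (x %/ d)] is at most [B * d / x], the convolution is bounded by [B / x] times the sum of
   ln(x / d), which is at most [x]. *)
pose g d := moebius R d * (lnn R x - lnn R d).
have -> : Tsum x + (lnn R x)%:C =
    \sum_(1 <= n < x.+1) chi n * ((\sum_(d <- divisors n) g d) / n%:R)%:C.
  have gE n : (0 < n)%N -> \sum_(d <- divisors n) g d =
      mangoldt R n + (if n == 1%N then lnn R x else 0).
    move=> n0; rewrite /g (eq_bigr (fun d => moebius R d * lnn R x - moebius R d * lnn R d)).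
      rewrite sumrB sum_moebius_ln // -mulr_suml sum_moebius // opprK addrC.
      by case: ifP; rewrite ?mul1r ?mul0r.
    by move=> d _; rewrite mulrBr.
  transitivity (\sum_(1 <= n < x.+1) (chi n * (mangoldt R n / n%:R)%:C +
      chi n * ((if n == 1%N then lnn R x else 0) / n%:R)%:C)).
    rewrite big_split /=; congr +%R.
    rewrite big_ltn // eqxx chi1 divr1 mul1r big_nat big1 ?addr0 // => n /andP[n1 _].
    by rewrite gtn_eqF // mul0r mulr0.
  rewrite !big_nat; apply: eq_bigr => n /andP[n0 _].
  by rewrite gE // mulrDl rmorphD mulrDr.
rewrite chi_convolution; apply: le_trans (normc_sum _ _ _) _.
apply: (@le_trans _ _ (\sum_(1 <= d < x.+1) (lnn R x - lnn R d) * (B / x%:R))).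
  apply: ler_sum_nat => d /andP[d0 dx].
  have d0' : 0 < d%:R :> R by rewrite ltr0n.
  have l0 : 0 <= lnn R x - lnn R d by rewrite subr_ge0 le_lnn.
  rewrite !Normc.normcM normc_real /g normrM normrM.
  rewrite [ `|lnn R x - _|]ger0_norm // [ `|_^-1|]ger0_norm ?invr_ge0 //.
  apply: (@le_trans _ _ (1 * (1 * (lnn R x - lnn R d) / d%:R) * (B * (d%:R / x%:R)))).
    apply: ler_pM; rewrite ?mulr_ge0 ?normc_ge0 ?invr_ge0 //.
      apply: ler_pM; rewrite ?mulr_ge0 ?normc_ge0 ?invr_ge0 //.
      by rewrite !ler_wpM2r ?invr_ge0 // norm_moebius.
    by apply: le_trans (van _) _; rewrite ler_wpM2l // inv_quot_le.
  by rewrite !mul1r le_eqVlt; apply/orP; left; apply/eqP; field; rewrite !gt_eqF.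
rewrite -mulr_suml mulrA ler_pdivrMr // mulrC ler_wpM2l //.
exact: sum_ln_ratio.
Qed.

End BoundedCharacterSums.

(** * Nonvanishing for real characters *)

Section RealCharacters.
Variables (R : realType) (rho : nat -> R) (B : R).
Hypothesis rho_bounded : forall a b, `|\sum_(a <= n < b) rho n| <= B.
Hypothesis rhoM : forall a b, rho (a * b)%N = rho a * rho b.
Hypothesis rho1 : rho 1 = 1.
Hypothesis rho_sign : forall n, [\/ rho n = 0, rho n = 1 | rho n = -1].

Let divsum n := \sum_(d <- divisors n) rho d.

Lemma norm_rho n : `|rho n| <= 1.
Proof. by case: (rho_sign n) => ->; rewrite ?normrN ?normr1 ?normr0. Qed.

Lemma real_abel_bound (f : nat -> R) a b :
  (forall n, (a <= n)%N -> 0 <= f n) -> (forall n, (a <= n)%N -> f n.+1 <= f n) ->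
  `|\sum_(a <= n < b) rho n * f n| <= B * f a.
Proof.
move=> f0 fdec; have := @abel_bound R (fun n => (rho n)%:C) B _ f a b f0 fdec.
under eq_bigr do rewrite -rmorphM; rewrite -rmorph_sum normc_real; apply.
by move=> c d; rewrite -rmorph_sum normc_real.
Qed.

(** For [rho p] equal to 1 the sum is [a], for -1 it is the parity of [a], and for 0 only the term
    of index 0 survives. An odd number of terms corresponds to an even exponent of [p]. *)
Lemma geom_rho_ge0 p a : 0 <= \sum_(i < a) rho p ^+ i /\
  (odd a -> 1 <= \sum_(i < a) rho p ^+ i).
Proof.
elim: a => [|a [IH1 IH2]]; first by rewrite big_ord0.
rewrite big_ord_recl expr0.
have -> : \sum_(i < a) rho p ^+ lift ord0 i = rho p * \sum_(i < a) rho p ^+ i.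
  by rewrite mulr_sumr; apply: eq_bigr => i _; rewrite exprS.
set t := \sum_(i < a) _ in IH1 IH2 *.
case: (rho_sign p) => [->|->|rN]; rewrite ?rN; try by split; lra.
suff -> : t = (odd a)%:R by rewrite /=; case: (odd a) => /=; split=> // *; lra.
rewrite /t rN; elim: (a) => [|k IHk]; first by rewrite big_ord0.
by rewrite big_ord_recr /= IHk -signr_odd; case: odd; rewrite ?expr1 ?expr0 /=; lra.
Qed.

Lemma divsum_pow_mul p a n : prime p -> ~~ (p %| n)%N -> (0 < n)%N ->
  divsum (p ^ a * n) = (\sum_(i < a.+1) rho p ^+ i) * divsum n.
Proof.
move=> pp pn n0; rewrite /divsum sum_divisors_pow // mulr_suml.
apply: eq_bigr => i _; rewrite mulr_sumr; apply: eq_bigr => d _.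
rewrite rhoM; congr *%R; elim: (nat_of_ord i) => [|k IHk]; first by rewrite rho1.
by rewrite expnS rhoM IHk exprS.
Qed.

(** [divsum] is a product of the local sums of [geom_rho_ge0]. Evenness of all exponents, rather
    than being a square, is assumed because it passes directly to the part prime to [p]. *)
Lemma divsum_ge n : (0 < n)%N ->
  0 <= divsum n /\ ((forall q, prime q -> ~~ odd (logn q n)) -> 1 <= divsum n).
Proof.
move: n; apply: prime_pow_ind => [|p a n pp pn n0 [IH1 IH2]].
  by rewrite /divsum divisors1 big_seq1 rho1.
rewrite divsum_pow_mul //; have [g0 g1] := geom_rho_ge0 p a.+2.
split=> [|sq]; first by rewrite mulr_ge0.
have p0 := prime_gt0 pp.
have lE q : prime q -> logn q (p ^ a.+1 * n) = ((q == p) * a.+1 + logn q n)%N.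
  by move=> qp; rewrite lognM ?expn_gt0 ?p0 // lognX logn_prime // mulnC.
have even_a : ~~ odd a.+1.
  have := sq p pp; rewrite lE // eqxx mul1n [logn p n]logn_coprime ?addn0 //.
  by rewrite prime_coprime.
rewrite -[1]mulr1 ler_pM ?ler01 //; first by apply: g1; rewrite /= even_a.
apply: IH2 => q qp; have := sq q qp; rewrite lE //.
case: eqP => [->|]; last by rewrite mul0n.
by move=> _; rewrite [logn p n]logn_coprime // prime_coprime.
Qed.

Lemma divsum_sqr k : (0 < k)%N -> 1 <= divsum (k ^ 2).
Proof.
move=> k0; have [|_ ->//] := @divsum_ge (k ^ 2); first by rewrite expn_gt0 k0.
by move=> q qp; rewrite lognX oddM.
Qed.

(** * Lambert series of a real character *)

Section Lambert.
Variable y : R.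
Hypotheses (y0 : 0 < y) (y1 : y < 1).
Let x := y ^+ 2.
Let qn n := \sum_(i < n) x ^+ i.

Let x0 : 0 < x. Proof. by rewrite exprn_gt0. Qed.
Let x1 : x < 1. Proof. by rewrite /x expr_lt1 // ltW. Qed.

(* AM-GM for 1, x, ..., x^(n-1); taking x = y^2 avoids square roots. *)
Lemma qn_ge n : n%:R * y ^+ n.-1 <= qn n.
Proof.
elim/ltn_ind: n => -[|[|n]] IHn; first by rewrite mul0r /qn big_ord0.
  by rewrite mul1r /qn big_ord1 !expr0.
have -> : qn n.+2 = 1 + x * qn n + x ^+ n.+1.
  rewrite /qn big_ord_recr /= big_ord_recl /= expr0 mulr_sumr; congr (_ + _ + _).
  by apply: eq_bigr => i _; rewrite exprS.
have IH := ler_wpM2l (ltW x0) (IHn n (leqW (leqnn _))).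
have -> : n.+2%:R * y ^+ n.+1 = n%:R * y ^+ n.+1 + 2 * y ^+ n.+1.
  by rewrite -addn2 natrD mulrDl.
have e1 : n%:R * y ^+ n.+1 = x * (n%:R * y ^+ n.-1).
  case: (n) => [|k]; first by rewrite !mul0r mulr0.
  by rewrite [RHS]mulrCA /x -exprD.
have e2 : x ^+ n.+1 = (y ^+ n.+1) ^+ 2 by rewrite /x -!exprM mulnC.
have := sqr_ge0 (1 - y ^+ n.+1); rewrite e1 e2 sqrrB expr1n mul1r; lra.
Qed.

Lemma qnE n : (1 - x) * qn n = 1 - x ^+ n.
Proof.
rewrite /qn -[1 in RHS](expr1n _ n) subrXX; congr *%R.
by apply: eq_bigr => i _; rewrite expr1n mul1r.
Qed.

Lemma qn_gt0 n : (0 < n)%N -> 0 < qn n.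
Proof. by move=> n0; apply: lt_le_trans (qn_ge n); rewrite mulr_gt0 ?ltr0n // exprn_gt0. Qed.

(** The main part [1 / (n * (1 - x))] of the Lambert term, minus that term. This difference is
    nonnegative and decreasing, hence open to Abel summation, while the main part sums to zero
    against [rho] when L(1, rho) = 0. *)
Let bn n := (n%:R * (1 - x))^-1 - x ^+ n / (1 - x ^+ n).

(** After clearing denominators this is [n * n.+1 * x ^+ n <= qn n * qn n.+1], the product of two
    instances of [qn_ge], with [x ^+ n = y ^+ n * y ^+ n]. *)
Lemma bn_dec n : (0 < n)%N -> bn n.+1 <= bn n.
Proof.
move=> n0; rewrite /bn -!qnE.
have q0 := qn_gt0 n0; have q1 := qn_gt0 (ltn0Sn n).
have nn0 : 0 < n%:R :> R by rewrite ltr0n.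
have xx : 0 < 1 - x by rewrite subr_gt0.
have key : n%:R * n.+1%:R * x ^+ n <= qn n * qn n.+1.
  have h1 : n%:R * y ^+ n <= qn n.
    apply: le_trans (qn_ge n); rewrite ler_wpM2l // -{1}(prednK n0) exprS.
    by rewrite ger_pMl ?exprn_gt0 // ltW.
  have h2 : n.+1%:R * y ^+ n <= qn n.+1 := qn_ge n.+1.
  have -> : n%:R * n.+1%:R * x ^+ n = (n%:R * y ^+ n) * (n.+1%:R * y ^+ n).
    by rewrite /x -exprM mulnC exprM; ring.
  by rewrite ler_pM // mulr_ge0 // exprn_ge0 // ltW.
have qS : qn n.+1 = qn n + x ^+ n by rewrite /qn big_ord_recr.
have xS : x ^+ n.+1 = x * x ^+ n by rewrite exprS.
have qx : (1 - x) * qn n = 1 - x ^+ n := qnE n.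
rewrite -subr_ge0.
have nE : n.+1%:R = n%:R + 1 :> R by rewrite natr1.
have n1 : 0 < n%:R + 1 :> R by lra.
rewrite xS nE in key *.
set Q := qn n in key q0 qS qx *; set Q' := qn n.+1 in key q1 qS *.
set X := x ^+ n in key qS qx *; set N : R := n%:R in key nn0 n1 *.
have -> : (N * (1 - x))^-1 - X / ((1 - x) * Q)
    - (((N + 1) * (1 - x))^-1 - x * X / ((1 - x) * Q')) =
    (Q * Q' - N * (N + 1) * X) / (N * (N + 1) * (1 - x) * (Q * Q')).
  have XE : X = 1 - (1 - x) * Q by lra.
  have Q'E : Q' = 1 + x * Q by rewrite qS XE; ring.
  rewrite Q'E in q1 *; rewrite XE.
  field; rewrite !gt_eqF //.
by rewrite divr_ge0 ?subr_ge0 // !mulr_ge0 // ltW.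
Qed.

Lemma bn_ge0 n : (0 < n)%N -> 0 <= bn n.
Proof.
move=> n0; rewrite /bn -qnE; have q0 := qn_gt0 n0.
have nn0 : 0 < n%:R :> R by rewrite ltr0n.
have xx : 0 < 1 - x by rewrite subr_gt0.
have h : n%:R * x ^+ n <= qn n.
  apply: le_trans (qn_ge n); rewrite ler_wpM2l // /x -exprM ler_wiXn2l ?ltW //; lia.
have -> : (n%:R * (1 - x))^-1 - x ^+ n / ((1 - x) * qn n) =
    (qn n - n%:R * x ^+ n) / (n%:R * (1 - x) * qn n).
  by field; rewrite !gt_eqF.
by rewrite divr_ge0 ?subr_ge0 // !mulr_ge0 // ltW.
Qed.

(** [M * y ^+ M] is at most the geometric sum of the powers of [y], hence at most [1 / (1 - y)];
    squaring gives the decay for [x]. *)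
Lemma pow_decay M : M%:R * x ^+ M <= ((1 - y) ^+ 2)^-1 / M%:R.
Proof.
case: M => [|m]; first by rewrite mul0r invr0 mulr0.
set M := m.+1; have M0 : 0 < M%:R :> R by rewrite ltr0n.
have yy : 0 < 1 - y by rewrite subr_gt0.
have h : M%:R * y ^+ M * (1 - y) <= 1.
  have : \sum_(i < M) y ^+ M <= \sum_(i < M) y ^+ i.
    apply: ler_sum => i _; apply: ler_wiXn2l; rewrite ?ltW //; exact: ltnW.
  rewrite sumr_const card_ord -[leLHS]mulr_natl => le.
  apply: le_trans (ler_wpM2r (ltW yy) le) _; rewrite mulrC.
  have -> : (1 - y) * \sum_(i < M) y ^+ i = 1 - y ^+ M.
    rewrite -[1 in RHS](expr1n _ M) subrXX; congr *%R.
    by apply: eq_bigr => i _; rewrite expr1n mul1r.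
  by rewrite gerBl exprn_ge0 // ltW.
rewrite ler_pdivlMr // -[leRHS]mul1r ler_pdivlMr ?exprn_gt0 //.
have -> : M%:R * x ^+ M * M%:R * (1 - y) ^+ 2 = (M%:R * y ^+ M * (1 - y)) ^+ 2.
  by rewrite /x -exprM mulnC exprM; ring.
by rewrite exprn_ile1 // !mulr_ge0 ?exprn_ge0 // ltW.
Qed.

Hypothesis vanish : forall N, `|\sum_(1 <= n < N.+1) rho n / n%:R| <= B / N.+1%:R.

(** Finite form of the identity of Lambert series: the sum of [divsum j * x ^+ j] equals that of
    [rho d * x ^+ d / (1 - x ^+ d)], which for L(1, rho) = 0 is minus the sum of [rho d * bn d], at
    most [B]. The terms over [M] account for truncation. *)
Lemma lambert_bound M : (0 < M)%N ->
  \sum_(1 <= j < M.+1) divsum j * x ^+ j <=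
  B + (B / (1 - x) + ((1 - y) ^+ 2)^-1 / (1 - x)) / M%:R.
Proof.
move=> M0; have M0' : 0 < M%:R :> R by rewrite ltr0n.
have xx : 0 < 1 - x by rewrite subr_gt0.
have B0 : 0 <= B by apply: le_trans (rho_bounded 0 0).
have xd d : (0 < d)%N -> 0 < 1 - x ^+ d.
  by move=> d0; rewrite subr_gt0 exprn_ilt1 ?ltW //; lia.
pose g d := x ^+ d / (1 - x ^+ d).
have -> : \sum_(1 <= j < M.+1) divsum j * x ^+ j =
    \sum_(1 <= d < M.+1) rho d * (\sum_(1 <= k < (M %/ d).+1) x ^+ (d * k)).
  transitivity (\sum_(1 <= j < M.+1) \sum_(d <- divisors j) rho d * x ^+ j).
    by apply: eq_bigr => j _; rewrite mulr_suml.
  by rewrite exchange_divisors; apply: eq_bigr => d _; rewrite mulr_sumr.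
(* Cutting the geometric series in [x ^+ d] at [M %/ d] loses a tail starting at an exponent above
   [M], so at most [x ^+ M / (1 - x)] for each [d]. *)
have step1 : \sum_(1 <= d < M.+1) rho d * (\sum_(1 <= k < (M %/ d).+1) x ^+ (d * k)) <=
    \sum_(1 <= d < M.+1) rho d * g d + M%:R * x ^+ M / (1 - x).
  have -> : M%:R * x ^+ M / (1 - x) = \sum_(1 <= d < M.+1) x ^+ M / (1 - x).
    by rewrite sumr_const_nat subn1 -[RHS]mulr_natl mulrA.
  rewrite -big_split /=; apply: ler_sum_nat => d /andP[d0 dM].
  have d1 := xd d d0.
  have -> : \sum_(1 <= k < (M %/ d).+1) x ^+ (d * k) = g d - x ^+ (d * (M %/ d).+1) / (1 - x ^+ d).
    elim: (M %/ d)%N => [|k IHk]; first by rewrite big_geq // muln1 subrr.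
    rewrite big_nat_recr //= IHk (mulnS d k.+1) exprD; field.
    by rewrite gt_eqF.
  rewrite mulrBr lerD2l -mulrN; apply: le_trans (ler_norm _) _.
  rewrite normrM normrN -[leRHS]mul1r ler_pM ?normr_ge0 ?norm_rho //.
  rewrite ger0_norm ?divr_ge0 ?exprn_ge0 ?(ltW y0) ?(ltW d1) //.
  apply: ler_pM; rewrite ?invr_ge0 ?exprn_ge0 ?(ltW y0) ?(ltW d1) //.
    by apply: ler_wiXn2l; rewrite ?ltW //; have := ltn_ceil M d0; rewrite mulnC; lia.
  by rewrite lef_pV2 ?posrE // lerD2l lerN2 -[leRHS]expr1 ler_wiXn2l ?ltW.
have step2 : \sum_(1 <= d < M.+1) rho d * g d =
    (\sum_(1 <= d < M.+1) rho d / d%:R) / (1 - x) - \sum_(1 <= d < M.+1) rho d * bn d.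
  rewrite mulr_suml -sumrB; apply: eq_bigr => d _.
  rewrite /bn -/(g d) invfM; move: (g d) (1 - x)^-1 => G u; ring.
have step3 : `|\sum_(1 <= d < M.+1) rho d * bn d| <= B.
  apply: le_trans (real_abel_bound _ _ _) _.
  - by move=> n; apply: bn_ge0.
  - by move=> n; apply: bn_dec.
  suff -> : bn 1 = 1 by rewrite mulr1.
  by rewrite /bn mul1r expr1; field; rewrite gt_eqF.
have step4 : (\sum_(1 <= d < M.+1) rho d / d%:R) / (1 - x) <= B / (1 - x) / M%:R.
  rewrite mulrAC ler_pM2r ?invr_gt0 //; apply: le_trans (ler_norm _) _.
  apply: le_trans (vanish M) _; rewrite ler_wpM2l //.
  by rewrite lef_pV2 ?posrE ?ltr0n // ler_nat.
have step5 : M%:R * x ^+ M / (1 - x) <= ((1 - y) ^+ 2)^-1 / (1 - x) / M%:R.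
  by rewrite [leRHS]mulrAC ler_pM2r ?invr_gt0 // pow_decay.
rewrite mulrDl.
have := step3; rewrite ler_norml => /andP[step3' _].
rewrite step2 in step1.
have H (a b c d e f h : R) :
  a <= b - c + d -> - e <= c -> b <= f -> d <= h -> a <= e + (f + h) by lra.
exact: H step1 step3' step4 step5.
Qed.

End Lambert.
Lemma sum_squares_le (h : nat -> R) K : (forall n, (0 < n)%N -> 0 <= h n) ->
  \sum_(1 <= k < K.+1) h (k ^ 2)%N <= \sum_(1 <= j < (K ^ 2).+1) h j.
Proof.
move=> h0; elim: K => [|K IHK]; first by rewrite !big_geq.
have lt : (K ^ 2 < K.+1 ^ 2)%N by rewrite ltn_exp2r.
rewrite big_nat_recr // [leRHS]big_nat_recr /=; last by rewrite expn_gt0.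
rewrite lerD2r; apply: le_trans IHK _.
rewrite [leRHS](big_cat_nat (n := (K ^ 2).+1)) //= lerDl.
by rewrite big_nat_cond sumr_ge0 // => n /andP[/andP[n0 _] _]; apply: h0; exact: leq_ltn_trans n0.
Qed.

Lemma bernoulli_pow (t : R) n : 0 <= t <= 1 -> 1 - n%:R * t <= (1 - t) ^+ n.
Proof.
move=> /andP[t0 t1]; elim: n => [|n IHn]; first by rewrite mul0r subr0 expr0.
rewrite exprSr -natr1; apply: le_trans (ler_wpM2r _ IHn); last by lra.
have : 0 <= n%:R * t * t by rewrite !mulr_ge0.
by lra.
Qed.

(** For [x] close to 1 the squares up to [K ^ 2] alone contribute at least [K / 2] to the series of
    [divsum], whereas [lambert_bound] keeps it below [B + 1] for large [M]; [K] is chosen above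
    [2 * B + 2]. *)
Lemma real_nonvanish :
  ~ (forall N, `|\sum_(1 <= n < N.+1) rho n / n%:R| <= B / N.+1%:R).
Proof.
move=> van; have B0 : 0 <= B by apply: le_trans (rho_bounded 0 0).
have [K KB] : exists K : nat, 2 * B + 2 < K%:R.
  by exists (Num.bound (2 * B + 2)); apply: archi_boundP; lra.
have K0 : 0 < K%:R :> R by lra.
(* With [x = (1 - t) ^+ 2], Bernoulli gives [x ^+ (k ^ 2) >= 1 - 2 * k ^ 2 * t], which is at least
   1/2 for [k <= K]. *)
pose t : R := (4 * K%:R ^+ 2)^-1.
have K1 : 1 <= K%:R :> R by rewrite ler1n -(ltr0n R).
have K4 : 0 < 4 * K%:R ^+ 2 :> R by apply: mulr_gt0; [lra|exact: exprn_gt0].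
have t0 : 0 < t by rewrite invr_gt0.
have tK : t * (4 * K%:R ^+ 2) = 1 by rewrite /t mulVf // gt_eqF.
have K2 : 1 <= K%:R ^+ 2 :> R by rewrite exprn_ege1.
have t1 : t < 1 by nra.
have y0 : 0 < 1 - t by lra.
have y1 : 1 - t < 1 by lra.
pose x : R := (1 - t) ^+ 2.
pose W := B / (1 - x) + ((1 - (1 - t)) ^+ 2)^-1 / (1 - x).
have [m mW] : exists m : nat, `|W| < m%:R by exists (Num.bound `|W|); apply: archi_boundP.
pose M := (K ^ 2 + m.+1)%N.
have M_gt0 : (0 < M)%N by rewrite /M addnS.
have := @lambert_bound _ y0 y1 van M M_gt0.
rewrite -/x -/W => up.
have x0 : 0 <= x by rewrite sqr_ge0.
have h0 n : (0 < n)%N -> 0 <= divsum n * x ^+ n.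
  by move=> n0; apply: mulr_ge0; [case: (divsum_ge n0)|exact: exprn_ge0].
have M0 : 0 < M%:R :> R by rewrite ltr0n.
have WM : W / M%:R <= 1.
  rewrite ler_pdivrMr // mul1r; apply: le_trans (ler_norm _) _; apply: le_trans (ltW mW) _.
  by rewrite ler_nat /M (leq_trans (leqnSn m)) // leq_addl.
have lo1 : \sum_(1 <= j < (K ^ 2).+1) divsum j * x ^+ j <=
    \sum_(1 <= j < M.+1) divsum j * x ^+ j.
  have KM : ((K ^ 2).+1 <= M.+1)%N by rewrite ltnS /M leq_addr.
  rewrite [leRHS](big_cat_nat (n := (K ^ 2).+1)) //= lerDl.
  by rewrite big_nat_cond sumr_ge0 // => n /andP[/andP[n0 _] _]; apply: h0; exact: leq_ltn_trans n0.
have lo2 := sum_squares_le K h0.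
have lo3 : \sum_(1 <= k < K.+1) (1 / 2 : R) <=
    \sum_(1 <= k < K.+1) divsum (k ^ 2) * x ^+ (k ^ 2).
  apply: ler_sum_nat => k /andP[k0 kK].
  have half0 : 0 <= 1 / 2 :> R by lra.
  rewrite -[leLHS]mul1r ler_pM ?ler01 ?divsum_sqr //.
  rewrite /x -exprM; apply: le_trans (bernoulli_pow _ _); last by lra.
  have kK' : k%:R ^+ 2 <= K%:R ^+ 2 :> R by rewrite ler_pXn2r ?nnegrE // ler_nat.
  rewrite natrM natrX.
  have : t * k%:R ^+ 2 <= t * K%:R ^+ 2 by rewrite ler_pM2l.
  by lra.
rewrite sumr_const_nat subn1 /= -mulr_natl in lo3.
lra.
Qed.

End RealCharacters.

(** * Dirichlet characters *)

(** The irreducible characters of [G] are linear and their kernels meet trivially, so one of them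
    separates [u] from 1. Its values are algebraic numbers; keeping only their exponents relative to
    a primitive root lets them be transported to [R[i]]. *)
Lemma abelian_separation (gT : finGroupType) (G : {group gT}) (N : nat) (u : gT) :
  abelian G -> (#|G| %| N)%N -> (1 < N)%N -> u \in G -> u != 1%g ->
  exists k : gT -> nat,
    (forall x y, x \in G -> y \in G -> k (x * y)%g = k x + k y %[mod N])%N /\
    (k u != 0 %[mod N])%N.
Proof.
move=> abG dvdN N1 uG u1; have N0 := ltnW N1.
have [z prim_z] := C_prim_root_exists N0.
have [i chi_u] : exists i : Iirr G, 'chi_i u != 1.
  apply/existsP; apply: contraNT u1; rewrite negb_exists => /forallP all1.
  rewrite -finset.in_set1 -set1gE -(TI_cfker_irr G); apply/bigcapP => i _.
  rewrite cfkerEirr inE lin_char1 ?(char_abelianP _ abG) //.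
  by have := all1 i; rewrite negbK.
have lin_i : 'chi_i \is a linear_char := char_abelianP _ abG i.
have ex x : x \in G -> exists k : 'I_N, 'chi_i x == z ^+ k.
  move=> xG; have : ('chi_i x) ^+ N = 1.
    have /dvdnP[c ->] : (#[x]%g %| N)%N by apply: dvdn_trans dvdN; apply: order_dvdG.
    by rewrite mulnC exprM lin_char_unity_root // expr1n.
  by case/(prim_rootP prim_z) => k ->; exists k.
pose k x := if [pick k : 'I_N | 'chi_i x == z ^+ k] is Some k then nat_of_ord k else 0%N.
have kP x : x \in G -> z ^+ k x = 'chi_i x.
  move=> xG; rewrite /k; case: pickP => [j /eqP ->//|none].
  by have [j] := ex x xG; rewrite none.
exists k; split=> [x y xG yG|].
  by apply/eqP; rewrite -(eq_prim_root_expr prim_z) exprD !kP ?groupM // lin_charM.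
by rewrite -(eq_prim_root_expr prim_z) kP.
Qed.

Section PrimitiveRoot.
Variable R : realType.
Local Notation normc := (@Normc.normc R).

Lemma complex_prim_root N : (0 < N)%N -> exists w : R[i], N.-primitive_root w.
Proof.
move=> N0; pose p : {poly R[i]} := 'X^N - 1.
have [rs pE] := closed_field_poly_normal p.
have lead1 : lead_coef p = 1 by rewrite lead_coefXnsubC.
rewrite lead1 scale1r in pE.
have sz : size rs = N.
  have : size p = N.+1 by rewrite size_XnsubC.
  by rewrite pE size_prod_XsubC => -[].
have uniq_rs : uniq rs.
  rewrite -separable_prod_XsubC -pE; apply: separable_Xn_sub_1.
  by rewrite pnatr_eq0; lia.
have all_rs : all N.-unity_root rs.
  apply/allP => r rrs; rewrite unity_rootE -subr_eq0.
  have : root p r by rewrite pE root_prod_XsubC.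
  by rewrite /root !hornerE.
have /hasP[w _ prim_w] : has N.-primitive_root rs by apply: has_prim_root; rewrite ?sz.
by exists w.
Qed.

Lemma normc_prim_root N (w : R[i]) : (0 < N)%N -> N.-primitive_root w -> normc w = 1.
Proof.
move=> N0 /prim_expr_order wN.
have : normc w ^+ N = 1.
  rewrite -(Normc.normc1 R) -wN; elim: (N) => [|k IHk]; first by rewrite !expr0 Normc.normc1.
  by rewrite !exprS Normc.normcM IHk.
by move/eqP; rewrite pexprn_eq1 ?normc_ge0 // => /orP[/eqP|/eqP//]; lia.
Qed.

End PrimitiveRoot.

Section PeriodicSums.
Variables (R : realType) (m : nat) (g : nat -> R[i]).
Local Notation normc := (@Normc.normc R).
Hypothesis m_gt0 : (0 < m)%N.
Hypothesis g_period : forall n, g (m + n)%N = g n.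
Hypothesis g_sum0 : \sum_(0 <= n < m) g n = 0.
Hypothesis g_norm : forall n, normc (g n) <= 1.

Lemma periodic_prefix_bound b : normc (\sum_(0 <= n < b) g n) <= m%:R.
Proof.
elim/ltn_ind: b => b IHb.
have [bm|mb] := ltnP b m.
  apply: le_trans (normc_sum _ _ _) _.
  apply: (@le_trans _ _ (\sum_(0 <= n < b) 1)); first exact: ler_sum.
  by rewrite sumr_const_nat subn0 ler_nat ltnW.
rewrite (big_cat_nat (n := m)) //= g_sum0 add0r -{1}[m]add0n big_addn.
under eq_bigr do rewrite addnC g_period.
by apply: IHb; lia.
Qed.

Lemma periodic_sum_bound a b : normc (\sum_(a <= n < b) g n) <= 2 * m%:R.
Proof.
have [ba|ab] := leqP b a; first by rewrite big_geq // Normc.normc0 mulr_ge0.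
have -> : \sum_(a <= n < b) g n = \sum_(0 <= n < b) g n - \sum_(0 <= n < a) g n.
  by rewrite [X in _ = X - _](big_cat_nat (n := a) (leq0n a) (ltnW ab)) /= addrAC subrr add0r.
apply: le_trans (le_normcD _ _) _; rewrite normcN.
have := periodic_prefix_bound a; have := periodic_prefix_bound b; lra.
Qed.

End PeriodicSums.

Section DirichletCharacters.
Variables (R : realType) (m N : nat) (w : R[i]).
Local Notation normc := (@Normc.normc R).
Hypotheses (m1 : (1 < m)%N) (N1 : (1 < N)%N).
Hypothesis prim_w : N.-primitive_root w.
Hypothesis dvdN : (#|[set: {unit 'Z_m}]| %| N)%N.

(* Characters of (Z/m)^* are encoded additively, by the exponent of the root of unity w; the
   value 0 outside the units makes the encoding injective. *)
Definition dchars : {set {ffun 'Z_m -> 'Z_N}} :=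
  [set f : {ffun 'Z_m -> 'Z_N} | [forall x, (x \isn't a GRing.unit) ==> (f x == 0)] &&
     [forall x, forall y, (x \is a GRing.unit) && (y \is a GRing.unit) ==>
        (f (x * y) == f x + f y)]].

Lemma dcharsP (f : {ffun 'Z_m -> 'Z_N}) :
  reflect ((forall x, x \isn't a GRing.unit -> f x = 0) /\
    (forall x y, x \is a GRing.unit -> y \is a GRing.unit -> f (x * y) = f x + f y))
   (f \in dchars).
Proof.
rewrite inE; apply: (iffP andP) => -[f0 fM]; split.
- by move=> x xn; have /forallP/(_ x)/implyP/(_ xn)/eqP := f0.
- move=> x y xu yu; have /forallP/(_ x)/forallP/(_ y)/implyP := fM.
  by rewrite xu yu => /(_ isT)/eqP.
- by apply/forallP => x; apply/implyP => xn; rewrite f0.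
- by apply/forallP => x; apply/forallP => y; apply/implyP => /andP[xu yu]; rewrite fM.
Qed.

Lemma dchars0 : 0 \in dchars.
Proof. by apply/dcharsP; split=> *; rewrite !ffunE ?addr0. Qed.

Lemma dcharsD f g : f \in dchars -> g \in dchars -> f + g \in dchars.
Proof.
move=> /dcharsP[f0 fM] /dcharsP[g0 gM]; apply/dcharsP; split=> [x xn|x y xu yu].
  by rewrite ffunE f0 // g0 // addr0.
by rewrite !ffunE fM // gM // addrACA.
Qed.

Lemma dcharsN f : f \in dchars -> - f \in dchars.
Proof.
move=> /dcharsP[f0 fM]; apply/dcharsP; split=> [x xn|x y xu yu].
  by rewrite ffunE f0 // oppr0.
by rewrite !ffunE fM // opprD.
Qed.

Lemma wexpD (a b : 'Z_N) : w ^+ (a + b)%R = w ^+ a * w ^+ b.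
Proof.
rewrite -exprD; apply/eqP; rewrite (eq_prim_root_expr prim_w) /=.
suff -> : ((a + b) %% (Zp_trunc N).+2 = (a + b) %% N)%N by rewrite modn_mod.
by congr modn; rewrite Zp_cast.
Qed.

Lemma wexp_eq1 (a : 'Z_N) : (w ^+ a == 1) = (a == 0).
Proof.
rewrite -(prim_order_dvd prim_w); apply/idP/eqP => [|->]; last exact: dvdn0.
move=> Na; apply/val_inj => /=; apply/eqP; rewrite -leqn0 leqNgt; apply/negP => a0.
have := ltn_ord a; rewrite [X in (_ < X)%N]Zp_cast // => /leq_trans/(_ (dvdn_leq a0 Na)).
by rewrite ltnn.
Qed.

Lemma normc_wexp k : normc (w ^+ k) = 1.
Proof.
have nw : normc w = 1 by exact: normc_prim_root (ltnW N1) prim_w.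
elim: k => [|k IHk]; first by rewrite expr0 Normc.normc1.
by rewrite exprS Normc.normcM nw IHk mulr1.
Qed.

Definition dval (f : {ffun 'Z_m -> 'Z_N}) (x : 'Z_m) : R[i] :=
  if x \is a GRing.unit then w ^+ f x else 0.

Definition dchar (f : {ffun 'Z_m -> 'Z_N}) (n : nat) : R[i] := dval f n%:R.

Section OneCharacter.
Variable f : {ffun 'Z_m -> 'Z_N}.
Hypothesis fD : f \in dchars.

Lemma dvalM x y : dval f (x * y) = dval f x * dval f y.
Proof.
have [_ fM] := dcharsP _ fD; rewrite /dval unitrM.
case: ifP => [/andP[xu yu]|/negbT]; first by rewrite xu yu fM // wexpD.
by rewrite negb_and => /orP[/negPf ->|/negPf ->]; rewrite ?mul0r ?mulr0.
Qed.

Lemma dcharM a b : dchar f (a * b) = dchar f a * dchar f b.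
Proof. by rewrite /dchar natrM dvalM. Qed.

Lemma dval1 : dval f 1 = 1.
Proof.
have [_ fM] := dcharsP _ fD; rewrite /dval unitr1.
apply/eqP; rewrite wexp_eq1 -(inj_eq (addrI (f 1))) addr0 -fM ?unitr1 //.
by rewrite mulr1.
Qed.

Lemma dchar1 : dchar f 1 = 1. Proof. exact: dval1. Qed.

Lemma norm_dval x : normc (dval f x) <= 1.
Proof. by rewrite /dval; case: ifP => _; rewrite ?normc_wexp ?Normc.normc0 ?ler01. Qed.

Lemma dchar_period n : dchar f (m + n) = dchar f n.
Proof. by rewrite /dchar natrD pchar_Zp // add0r. Qed.

Lemma sum_dval : f != 0 -> \sum_x dval f x = 0.
Proof.
move=> fN0; have [f0 _] := dcharsP _ fD.
have [u fu] : exists u, f u != 0.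
  apply/existsP; apply: contraNT fN0; rewrite negb_exists => /forallP all0.
  by apply/eqP/ffunP => x; rewrite ffunE; apply/eqP; have := all0 x; rewrite negbK.
have uu : u \is a GRing.unit by apply: contraNT fu => un; rewrite f0.
have E : \sum_x dval f x = dval f u * \sum_x dval f x.
  rewrite mulr_sumr (reindex_inj (mulrI uu)) /=.
  by apply: eq_bigr => x _; rewrite dvalM.
apply/eqP; move/eqP: E; rewrite -subr_eq0 -{1}[\sum_x _]mul1r -mulrBl mulf_eq0.
by rewrite subr_eq0 eq_sym /dval uu wexp_eq1 (negPf fu).
Qed.

Lemma sum_dchar_period : f != 0 -> \sum_(0 <= n < m) dchar f n = 0.
Proof.
move=> fN0; rewrite -{1}(Zp_cast m1) big_mkord -[RHS](sum_dval fN0).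
by apply: eq_bigr => x _; rewrite /dchar natr_Zp.
Qed.

Lemma dchar_bounded : f != 0 ->
  forall a b, normc (\sum_(a <= n < b) dchar f n) <= 2 * m%:R.
Proof.
move=> fN0 a b; apply: periodic_sum_bound; first exact: ltnW.
- exact: dchar_period.
- exact: sum_dchar_period.
by move=> n; apply: norm_dval.
Qed.

Lemma dval_opp x : dval (- f) x = (dval f x)^*.
Proof.
rewrite /dval; case: ifP => _; last by rewrite conjc0.
have nz := normc_wexp (f x).
have zz : w ^+ f x * w ^+ (- f) x = 1 by rewrite -wexpD ffunE subrr expr0.
set z := w ^+ f x in nz zz *.
have zn0 : z != 0 by apply: contraTneq (oner_neq0 R) => z0; rewrite -nz z0 Normc.normc0 eqxx.
apply: (mulfI zn0); rewrite zz -sqr_normc.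
have -> : `|z| = (normc z)%:C by [].
by rewrite nz expr1n.
Qed.

Lemma dval_real x : - f = f ->
  [\/ dval f x = 0, dval f x = 1 | dval f x = -1].
Proof.
move=> ff; rewrite /dval; case: ifP => _; last by apply: Or31.
have := wexpD (f x) (f x); rewrite -{1}ff ffunE addNr expr0 => /esym/eqP.
by rewrite -expr2 sqrf_eq1 => /orP[] /eqP ->; [apply: Or32|apply: Or33].
Qed.

End OneCharacter.

Lemma dval0 x : dval 0 x = if x \is a GRing.unit then 1 else 0.
Proof. by rewrite /dval ffunE. Qed.

Lemma dchars_separate (u : 'Z_m) : u \is a GRing.unit -> u != 1 ->
  exists2 f, f \in dchars & dval f u != 1.
Proof.
move=> uu u1.
pose U : {unit 'Z_m} := FinRing.unit 'Z_m uu.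
have U1 : U != 1%g by apply: contraNneq u1 => /(congr1 val) /= ->.
have [k [kM ku]] := @abelian_separation _ [group of [set: {unit 'Z_m}]] N U
  (units_Zp_abelian m) dvdN N1 (finset.in_setT _) U1.
pose f : {ffun 'Z_m -> 'Z_N} :=
  [ffun x => if insub x : option {unit 'Z_m} is Some v then (k v)%:R else 0].
have fE (v : {unit 'Z_m}) : f (val v) = (k v)%:R by rewrite ffunE valK.
have eqk a b : (a = b %[mod N])%N -> a%:R = b%:R :> 'Z_N.
  by move=> ab; apply/val_inj; rewrite /= !val_Zp_nat.
exists f.
  apply/dcharsP; split=> [x xn|x y xu yu]; first by rewrite ffunE insubF //; apply/negbTE.
  rewrite -[x]/(val (FinRing.unit 'Z_m xu)) -[y]/(val (FinRing.unit 'Z_m yu)).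
  rewrite -[_ * _]/(val (FinRing.unit 'Z_m xu * FinRing.unit 'Z_m yu)%g) !fE -natrD.
  by apply: eqk; apply: kM; rewrite finset.in_setT.
rewrite /dval uu wexp_eq1 -[u]/(val U) fE; apply: contraNneq ku => /(congr1 val) /=.
by rewrite val_Zp_nat // => ->; rewrite mod0n.
Qed.

(** Translation by a character [g] whose value at [x] is not 1 permutes the characters and
    multiplies the sum by that value. *)
Lemma sum_dchars x :
  \sum_(f in dchars) dval f x = if x == 1 then #|dchars|%:R else 0.
Proof.
case: eqP => [->|/eqP x1].
  by rewrite -sum1_card natr_sum; apply: eq_bigr => f fD; rewrite dval1.
have [xu|xn] := boolP (x \is a GRing.unit); last first.
  by apply: big1 => f _; rewrite /dval (negPf xn).
have [g gD gx] := dchars_separate xu x1.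
have E : \sum_(f in dchars) dval f x = dval g x * \sum_(f in dchars) dval f x.
  rewrite mulr_sumr (reindex_inj (addrI g)) /=.
  rewrite (eq_bigl (mem dchars)) => [|f] /=.
    by apply: eq_bigr => f fD; rewrite /dval xu ffunE wexpD.
  apply/idP/idP => [gf|fD]; last exact: dcharsD.
  by rewrite -(addKr g f); apply: dcharsD => //; apply: dcharsN.
apply/eqP; move/eqP: E; rewrite -subr_eq0 -{1}[\sum_(f in _) _]mul1r -mulrBl mulf_eq0.
by rewrite subr_eq0 eq_sym (negPf gx).
Qed.

End DirichletCharacters.

(** * Dirichlet's theorem *)

Section DirichletTheorem.
Variable R : realType.
Local Notation normc := (@Normc.normc R).
Local Notation Re := (@complex.Re R).

Lemma Re_sum (I : Type) (r : seq I) (P : pred I) (F : I -> R[i]) :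
  Re (\sum_(i <- r | P i) F i) = \sum_(i <- r | P i) Re (F i).
Proof. by apply: (big_morph Re) => // -[a b] [c d]. Qed.

Lemma norm_Re (z : R[i]) : `|Re z| <= normc z.
Proof.
case: z => a b /=; rewrite -sqrtr_sqr ler_wsqrtr // lerDl sqr_ge0 //.
Qed.

Lemma lnn_not_bounded (K : R) x0 : ~ (forall x, (x0 <= x)%N -> lnn R x <= K).
Proof.
move=> H; have [n [n0 Kn]] := lnn_unbounded K.
have := H (maxn n x0) (leq_maxr _ _); have : lnn R n <= lnn R (maxn n x0).
  by apply: le_lnn => //; apply: leq_maxl.
lra.
Qed.

(** Prime powers that are not prime contribute at most 2, and the primes in [P] are at most [C]. It
    serves for the primes dividing [m], and for a residue class supposed to contain no large
    prime. *)
Lemma mangoldt_sum_bounded (P : pred nat) C x : (C <= x)%N ->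
  (forall n, prime n -> P n -> (n <= C)%N) ->
  \sum_(1 <= n < x.+1 | P n) mangoldt R n / n%:R <=
    2 + \sum_(1 <= n < C.+1) mangoldt R n / n%:R.
Proof.
move=> Cx PC.
have F0 n : 0 <= mangoldt R n / n%:R by rewrite divr_ge0 ?mangoldt_ge0.
apply: (@le_trans _ _ (\sum_(1 <= n < x.+1 | ~~ prime n) mangoldt R n / n%:R +
    \sum_(1 <= n < x.+1 | (n < C.+1)%N) mangoldt R n / n%:R)).
  rewrite !(big_mkcond (fun n => ~~ prime n)) (big_mkcond P) (big_mkcond (fun n => (n < C.+1)%N)).
  rewrite -big_split /=; apply: ler_sum => n _.
  case: ifP => [Pn|_]; last by rewrite addr_ge0 //; case: ifP.
  case: (boolP (prime n)) => [pn|_] /=; last by rewrite lerDl; case: ifP.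
  by rewrite ltnS PC // add0r.
rewrite [X in _ <= _ + X](big_nat_widen 1 C.+1 x.+1) //=.
by rewrite lerD ?sum_mangoldt_nonprime.
Qed.

Section Modulus.
Variables (m N : nat) (w : R[i]).
Hypotheses (m1 : (1 < m)%N) (N1 : (1 < N)%N).
Hypothesis prim_w : N.-primitive_root w.
Hypothesis dvdN : (#|[set: {unit 'Z_m}]| %| N)%N.

Local Notation dchars := (dchars m N).
Local Notation chi := (@dchar R m N w).
Local Notation B := (2 * m%:R : R).
Local Notation T f x := (Tsum (chi f) x).

Lemma unit_natr n : ((n%:R : 'Z_m) \is a GRing.unit) = coprime m n.
Proof. exact: unitZpE. Qed.

Lemma Tsum_principal : exists K : R, forall x, (m <= x)%N ->
  `|Re (T 0 x) - lnn R x| <= K.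
Proof.
exists (12 + (2 + \sum_(1 <= n < m.+1) mangoldt R n / n%:R)) => x mx.
have -> : Re (T 0 x) = \sum_(1 <= n < x.+1) mangoldt R n / n%:R -
    \sum_(1 <= n < x.+1 | ~~ coprime m n) mangoldt R n / n%:R.
  rewrite /Tsum Re_sum (big_mkcond (fun n => ~~ coprime m n)) -sumrB; apply: eq_bigr => n _.
  rewrite /dchar dval0 unit_natr.
  by case: coprime; rewrite ?mul1r ?mul0r ?subr0 ?subrr.
have x0 : (0 < x)%N by exact: leq_trans (ltnW m1) mx.
have := mertens R x0.
have : \sum_(1 <= n < x.+1 | ~~ coprime m n) mangoldt R n / n%:R <=
    2 + \sum_(1 <= n < m.+1) mangoldt R n / n%:R.
  apply: mangoldt_sum_bounded => // p pp; rewrite coprime_sym prime_coprime // negbK.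
  by apply: dvdn_leq; exact: ltnW.
have : 0 <= \sum_(1 <= n < x.+1 | ~~ coprime m n) mangoldt R n / n%:R.
  by apply: sumr_ge0 => n _; rewrite divr_ge0 ?mangoldt_ge0.
rewrite !ler_norml => ? ? /andP[? ?]; apply/andP; split; lra.
Qed.

(** Orthogonality: the weights [dval w f b] isolate the residue class inverse to [b]. *)
Lemma sum_Tsum_dchars (b : 'Z_m) x :
  \sum_(f in dchars) Re (dval w f b * T f x) =
  #|dchars|%:R * \sum_(1 <= n < x.+1 | b * n%:R == 1) mangoldt R n / n%:R.
Proof.
rewrite -Re_sum.
under eq_bigr => f fD.
  rewrite /Tsum mulr_sumr.
  under eq_bigr => n _ do rewrite mulrA /dchar -(dvalM N1 prim_w fD).
  over.
rewrite exchange_big /= (big_mkcond (fun n => b * n%:R == 1)) mulr_sumr Re_sum.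
apply: eq_bigr => n _; rewrite -mulr_suml (sum_dchars N1 prim_w dvdN).
case: ifP => _; last by rewrite mul0r mulr0.
by rewrite -(rmorph_nat (real_complex R)) -rmorphM.
Qed.

Lemma Re_Tsum_bounded_above f : f \in dchars -> f != 0 ->
  exists (K : R) x0, forall x, (x0 <= x)%N -> Re (T f x) <= K.
Proof.
move=> fD fN0; have bd := dchar_bounded m1 N1 prim_w fD fN0.
have chiM := dcharM N1 prim_w fD.
have nchi n : normc (chi f n) <= 1 by apply: norm_dval N1 prim_w _ _.
have [van|nvan] := pselect (Lvanish (chi f) B); last first.
  have [K [x0 KP]] := Tsum_nonvanish bd chiM nchi nvan.
  exists K, x0 => x xx; apply: le_trans (KP x xx).
  by apply: le_trans (norm_Re _); apply: ler_norm.
exists B, 1%N => x x0.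
have := Tsum_vanish bd chiM (dchar1 N1 prim_w fD) nchi van x0.
have := norm_Re (T f x + (lnn R x)%:C); have := lnn_ge0 R x.
have -> : Re (T f x + (lnn R x)%:C) = Re (T f x) + lnn R x by case: (T f x).
have := ler_norm (Re (T f x) + lnn R x); lra.
Qed.

Lemma common_bound (P : {ffun 'Z_m -> 'Z_N} -> R -> nat -> Prop) (A : pred {ffun 'Z_m -> 'Z_N}) :
  (forall f, A f -> exists (K : R) x0, forall x, (x0 <= x)%N -> P f K x) ->
  exists (K : {ffun 'Z_m -> 'Z_N} -> R) x0, forall f x, A f -> (x0 <= x)%N -> P f (K f) x.
Proof.
move=> H.
have H' f : exists y : R * nat, A f -> forall x, (y.2 <= x)%N -> P f y.1 x.
  have [/H[K [x0 KP]]|nA] := boolP (A f); first by exists (K, x0).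
  by exists (0, 0%N).
have [g gP] := choice H'.
exists (fun f => (g f).1), (\max_f (g f).2)%N => f x Af le.
by apply: gP => //; apply: leq_trans le; apply: leq_bigmax.
Qed.

(* A vanishing non-real character comes with its conjugate, and the sum of all T(x) would then
   be at most - ln x + O(1); it is nonnegative. *)
Lemma dchar_nonvanish f : f \in dchars -> f != 0 -> ~ Lvanish (chi f) B.
Proof.
move=> fD fN0 van.
have bd := dchar_bounded m1 N1 prim_w fD fN0.
have chiM := dcharM N1 prim_w fD.
have nchi g n : normc (chi g n) <= 1 by apply: norm_dval N1 prim_w _ _.
(* [- f] encodes the conjugate character, so equality means that the character is real. *)
have [ff|ff] := eqVneq (- f) f.
  pose rho n := Re (chi f n).
  have rhoE n : chi f n = (rho n)%:C.
    by rewrite /rho; case: (dval_real N1 prim_w n%:R ff); rewrite /dchar => -> //=; rewrite rmorphN.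
  apply: (@real_nonvanish R rho B).
  - move=> a b; have := bd a b.
    by under eq_bigr do rewrite rhoE; rewrite -rmorph_sum normc_real.
  - by move=> a b; apply: (@complexI R); rewrite rmorphM /= -!rhoE chiM.
  - by rewrite /rho (dchar1 N1 prim_w fD).
  - move=> n; rewrite /rho /dchar; case: (dval_real N1 prim_w n%:R ff) => ->.
    + exact: Or31. + exact: Or32. + exact: Or33.
  - move=> M; have := van M; rewrite /Lsum.
    by under eq_bigr do rewrite rhoE -rmorphM; rewrite -rmorph_sum normc_real.
have nfD := dcharsN fD.
have nfN0 : - f != 0 by rewrite oppr_eq0.
have van' : Lvanish (chi (- f)) B.
  move=> M; apply: le_trans (van M); rewrite /Lsum.
  have -> : \sum_(1 <= n < M.+1) chi (- f) n * (n%:R^-1)%:C =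
      (\sum_(1 <= n < M.+1) chi f n * (n%:R^-1)%:C)^*.
    rewrite rmorph_sum; apply: eq_bigr => n _.
    by rewrite rmorphM /dchar (dval_opp N1 prim_w); congr *%R; rewrite -[LHS]conjc_real.
  by case: (\sum_(_ <= _ < _) _) => a b /=; rewrite sqrrN.
have neg g : g \in dchars -> g != 0 -> Lvanish (chi g) B ->
    forall x, (0 < x)%N -> Re (T g x) <= B - lnn R x.
  move=> gD gN0 vg x x0.
  have := Tsum_vanish (dchar_bounded m1 N1 prim_w gD gN0) (dcharM N1 prim_w gD)
    (dchar1 N1 prim_w gD) (nchi g) vg x0.
  have := norm_Re (T g x + (lnn R x)%:C).
  have -> : Re (T g x + (lnn R x)%:C) = Re (T g x) + lnn R x by case: (T g x).
  have := ler_norm (Re (T g x) + lnn R x); lra.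
pose A : pred {ffun 'Z_m -> 'Z_N} := [pred g | (g \in dchars) && (g != 0)].
have [K [x0 KP]] := @common_bound (fun g K x => Re (T g x) <= K) A
  (fun g => fun Ag => Re_Tsum_bounded_above (proj1 (andP Ag)) (proj2 (andP Ag))).
have [K0 K0P] := Tsum_principal.
pose C := K0 + 2 * B + \sum_(g | (g \in dchars) && (g != 0) && (g != f) && (g != - f)) K g.
apply: (@lnn_not_bounded C (maxn x0 m)) => x; rewrite geq_max => /andP[xx mx].
have x_gt0 : (0 < x)%N by lia.
have := sum_Tsum_dchars 1 x.
rewrite (bigD1 (0 : {ffun 'Z_m -> 'Z_N})) ?dchars0 //= (bigD1 f) /=; last by rewrite fD.
rewrite (bigD1 (- f)) /=; last by rewrite nfD nfN0.
have d1 g : g \in dchars -> dval w g 1 = 1 by apply: dval1.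
rewrite !d1 ?dchars0 // !mul1r.
have h0 : \sum_(g | (g \in dchars) && (g != 0) && (g != f) && (g != - f)) Re (dval w g 1 * T g x) <=
    \sum_(g | (g \in dchars) && (g != 0) && (g != f) && (g != - f)) K g.
  apply: ler_sum => g /andP[/andP[/andP[gD gN0] _] _]; rewrite d1 // mul1r.
  by apply: KP => //; rewrite /A /= gD.
have h1 := neg f fD fN0 van x x_gt0; have h2 := neg _ nfD nfN0 van' x x_gt0.
have := K0P x mx; rewrite ler_norml => /andP[_ h3].
have h4 : 0 <= #|dchars|%:R * \sum_(1 <= n < x.+1 | 1 * (n%:R : 'Z_m) == 1) mangoldt R n / n%:R.
  by rewrite mulr_ge0 // sumr_ge0 // => n _; rewrite divr_ge0 ?mangoldt_ge0.
move: h0 h1 h2 h3 h4; rewrite /C; move: (\sum_(g | _) Re _) (\sum_(g | _) K g).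
move: (_%:R * _) (Re (T f x)) (Re (T _ x)) (Re (T 0 x)) => *; lra.
Qed.

End Modulus.

(** With [b] the inverse of [a], the principal term grows like [ln x] and all others are bounded.
    Without primes above [B] in the class of [a], the sum over that class would be bounded too. *)
Lemma dirichlet a m B : (1 < m)%N -> coprime a m ->
  exists p, [/\ prime p, (B < p)%N & p = a %[mod m]].
Proof.
move=> m1 am; apply: contrapT => none.
(* Any multiple of the group order would do; doubling ensures [1 < N] even when the group of units
   is trivial. *)
pose N := (#|[set: {unit 'Z_m}]| * 2)%N.
have dvdN : (#|[set: {unit 'Z_m}]| %| N)%N by rewrite dvdn_mulr.
have N1 : (1 < N)%N.
  have : (0 < #|[set: {unit 'Z_m}]|)%N by rewrite cardG_gt0.
  by rewrite /N; lia.
have [w prim_w] := complex_prim_root R (ltnW N1).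
pose A : pred {ffun 'Z_m -> 'Z_N} := [pred g | (g \in dchars m N) && (g != 0)].
have [g Ag|K [x0 KP]] := @common_bound m N (fun g K x => normc (Tsum (dchar w g) x) <= K) A.
  have [gD gN0] := andP Ag.
  have nchi n : normc (dchar w g n) <= 1 by apply: norm_dval N1 prim_w _ _.
  exact: Tsum_nonvanish (dchar_bounded m1 N1 prim_w gD gN0) (dcharM N1 prim_w gD) nchi
    (dchar_nonvanish m1 N1 prim_w dvdN gD gN0).
have [K0 K0P] := @Tsum_principal m N w m1.
have au : (a%:R : 'Z_m) \is a GRing.unit by rewrite unitZpE // coprime_sym.
pose b : 'Z_m := a%:R^-1.
pose D := 2 + \sum_(1 <= n < B.+1) mangoldt R n / n%:R.
pose C := K0 + \sum_(g in dchars m N | g != 0) K g + #|dchars m N|%:R * D.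
apply: (@lnn_not_bounded C (maxn (maxn x0 m) B)) => x.
rewrite !geq_max => /andP[/andP[xx mx] Bx].
have := sum_Tsum_dchars N1 prim_w dvdN b x.
rewrite (bigD1 (0 : {ffun 'Z_m -> 'Z_N})) ?dchars0 //= dval0 unitrV au mul1r.
have h1 : - \sum_(g in dchars m N | g != 0) K g <=
    \sum_(g in dchars m N | g != 0) Re (dval w g b * Tsum (dchar w g) x).
  rewrite -sumrN; apply: ler_sum => g /andP[gD gN0].
  have Ag : A g by rewrite /A /= gD.
  have := KP g x Ag xx; have := norm_Re (dval w g b * Tsum (dchar w g) x).
  rewrite Normc.normcM ler_norml => /andP[h _] h'; rewrite lerNl.
  apply: le_trans h'; rewrite lerNl; apply: le_trans h; rewrite lerN2.
  by rewrite -[leRHS]mul1r ler_wpM2r ?normc_ge0 //; apply: norm_dval N1 prim_w _ _.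
have := K0P x mx; rewrite ler_norml => /andP[h2 _].
have h3 : \sum_(1 <= n < x.+1 | b * n%:R == 1) mangoldt R n / n%:R <= D.
  apply: mangoldt_sum_bounded => // p pp /eqP bp; rewrite leqNgt; apply/negP => Bp.
  apply: none; exists p; split=> //.
  have : (p%:R : 'Z_m) = a%:R * (b * p%:R) by rewrite mulrA divrr // mul1r.
  by rewrite bp mulr1 => /(congr1 val); rewrite /= !val_Zp_nat.
have := ler_wpM2l (ler0n R #|dchars m N|) h3.
rewrite /C; lra.
Qed.

End DirichletTheorem.

(** * Comparison with log log n and conclusion *)

Local Open Scope classical_set_scope.
Local Open Scope ring_scope.

(** The estimate [ln 2 >= 1/2] explains the constants: [n >= 2 ^ 8] gives [ln n >= 4] and then
    [ln (ln n) >= 1]. From [2 ^ k <= n.+1 <= n ^ 2] comes [k <= 4 * ln n], hence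
    [L <= 2 + 2 * ln (ln n)], and the remaining 3 is absorbed by [3 * ln (ln n)]. *)
Lemma trunc_loglog_le (R : realType) n : (256 <= n)%N ->
  (trunc_log 2 (trunc_log 2 n.+1)).+1%:R <= 5 * ln (ln n%:R) :> R.
Proof.
move=> n256; set k := trunc_log 2 n.+1; set L := trunc_log 2 k.
have l2 : 1 / 2 <= ln 2 :> R := lnn2_ge R.
have ln_pow (r : R) j : 0 < r -> ln (r ^+ j) = j%:R * ln r.
  by move=> r0; rewrite lnXn // mulr_natl.
have n0 : 0 < n%:R :> R by rewrite ltr0n (leq_trans _ n256).
have lnn4 : 4 <= ln n%:R :> R.
  apply: (@le_trans _ _ (ln (2 ^+ 8))); first by rewrite ln_pow //; lra.
  by rewrite ler_ln ?posrE ?exprn_gt0 // -natrX ler_nat.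
have lnln1 : 1 <= ln (ln n%:R) :> R.
  apply: (@le_trans _ _ (ln (2 ^+ 2))); first by rewrite ln_pow //; lra.
  by rewrite ler_ln ?posrE ?exprn_gt0 //; lra.
have k0 : (0 < k)%N by rewrite trunc_log_gt0 /=; lia.
have Lk : (2 ^ L <= k)%N by apply: trunc_logP.
have kn : (2 ^ k <= n ^ 2)%N.
  by apply: leq_trans (trunc_logP _ _) _ => //; nia.
have kR : k%:R * ln 2 <= 2 * ln n%:R :> R.
  rewrite -!ln_pow // ler_ln ?posrE ?exprn_gt0 // -!natrX ler_nat //.
have LR : L%:R * ln 2 <= 2 * ln 2 + ln (ln n%:R) :> R.
  have kle : k%:R <= 2 ^+ 2 * ln n%:R :> R.
    have : k%:R * (1 / 2) <= k%:R * ln 2 :> R by rewrite ler_wpM2l.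
    by lra.
  have lnn0 : 0 < ln n%:R :> R by lra.
  rewrite -!ln_pow // -lnM ?posrE ?exprn_gt0 // ler_ln ?posrE ?exprn_gt0 ?mulr_gt0 ?exprn_gt0 //.
  by apply: le_trans kle; rewrite -natrX ler_nat.
rewrite -natr1; have : L%:R * (1 / 2) <= L%:R * ln 2 :> R by rewrite ler_wpM2l.
have : L%:R <= 2 + ln (ln n%:R) / ln 2 :> R.
  by have l20 : 0 < ln 2 :> R by [lra]; rewrite -(ler_pM2r l20) mulrDl divfK ?gt_eqF.
have : ln (ln n%:R) / ln 2 <= 2 * ln (ln n%:R) :> R.
  have l20 : 0 < ln 2 :> R by lra.
  by rewrite ler_pdivrMr //; nra.
lra.
Qed.

Theorem theorem2p2 (R : realType) :
  [/\ (forall n : nat, (0 < n)%N -> (s n.+1 <= s n + 1)%N),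
      (exists C : R, 0 < C /\
         \forall n \near \oo,
           (s n)%:R - C * ln (ln n%:R) <= (s n.+1)%:R)
    & limn_einf (fun n : nat => ((s n.+1)%:R - (s n)%:R : R)%:E) = -oo%E].
Proof.
split.
- by move=> n n0; have := s_succ n0; lia.
- exists 5; split; first by lra.
  exists 256%N => // n /= n256.
  have n0 : (0 < n)%N by exact: leq_trans n256.
  have lnE := @trunc_loglog_le R n n256.
  have : (s n <= s n.+1 + (trunc_log 2 (trunc_log 2 n.+1)).+1)%N.
    have := s_succ n0; have := size_drops (ltn0Sn n).
    by move=> le eq; rewrite -ltnS eq -addnS leq_add2l.
  rewrite -(ler_nat R) natrD; lra.
rewrite limn_einf_lim.
(* Every tail infimum is already minus infinity: at a prime [p > n] supplied by [drops_chain], the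
   difference is [1 - size (drops p.+1)], which lies below the given [r]. *)
have -> : einfs (fun n : nat => ((s n.+1)%:R - (s n)%:R : R)%:E) = cst -oo%E.
  apply/funext => n /=; apply: eq_ninfty => r.
  have [p [pp np]] := drops_chain (dirichlet R) (Num.bound `|r|).+1 n.
  move=> ltp; apply: le_trans (ereal_inf_lbound _) _.
    by exists p => //=; apply: ltnW.
  rewrite lee_fin; have := s_succ (prime_gt0 pp) => /(congr1 (fun k => k%:R : R)).
  rewrite -natr1 natrD => eq.
  have : (Num.bound `|r|).+2%:R <= (size (drops p.+1))%:R :> R by rewrite ler_nat.
  have : `|r| < (Num.bound `|r|)%:R by apply: archi_boundP.
  have := ler_norm (- r); rewrite normrN -2!natr1; lra.
exact: lim_cst.
Qed.
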